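(* Let $(\mathfrak g_1,\mathfrak g_2)$ be a matched pair of Lie algebras and let $M$ be a left $\mathfrak g_1\bowtie\mathfrak g_2$-module whose restriction to $\mathfrak g_2$ is a locally finite $\mathfrak g_2$-module. Then, via the $\mathfrak g_1$-action on $M$ by restriction and the right coaction $\blacktriangledown_M:M\to M\otimes R(\mathfrak g_2)$, $\blacktriangledown_M(m)=m_{<0>}\otimes m_{<1>}$, determined by $v\cdot m=m_{<1>}(v)\,m_{<0>}$ for all $v\in U(\mathfrak g_2)$, $M$ becomes an induced $(\mathfrak g_1,R(\mathfrak g_2))$-module. Conversely, every induced $(\mathfrak g_1,R(\mathfrak g_2))$-module arises in this way.
   Context: Everything is over $\mathbb C$; Lie algebras are finite dimensional. Sweedler notation $\Delta(h)=h_{(1)}\otimes h_{(2)}$, right coactions $m\mapsto m_{<0>}\otimes m_{<1>}$. **Matched pair of Lie algebras.** $(\mathfrak g_1,\mathfrak g_2)$ is a matched pair if there are a left action $\triangleright:\mathfrak g_2\otimes\mathfrak g_1\to\mathfrak g_1$ and a right action $\triangleleft:\mathfrak g_2\otimes\mathfrak g_1\to\mathfrak g_2$ with $\zeta\triangleright[X,Y]=[\zeta\triangleright X,Y]+[X,\zeta\triangleright Y]+(\zeta\triangleleft X)\triangleright Y-(\zeta\triangleleft Y)\triangleright X$ and $[\zeta,\xi]\triangleleft X=[\zeta\triangleleft X,\xi]+[\zeta,\xi\triangleleft X]+\zeta\triangleleft(\xi\triangleright X)-\xi\triangleleft(\zeta\triangleright X)$. The double crossed sum $\mathfrak g_1\bowtie\mathfrak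 g_2$ is $\mathfrak g_1\oplus\mathfrak g_2$ with bracket $[X\oplus\zeta,Z\oplus\xi]=([X,Z]+\zeta\triangleright Z-\xi\triangleright X)\oplus([\zeta,\xi]+\zeta\triangleleft Z-\xi\triangleleft X)$. Multiplication $U(\mathfrak g_1)\otimes U(\mathfrak g_2)\to U(\mathfrak g_1\bowtie\mathfrak g_2)$ is bijective; let $\Psi(v\otimes u)\in U(\mathfrak g_1)\otimes U(\mathfrak g_2)$ be the element mapped to $vu$ ($v\in U(\mathfrak g_2),u\in U(\mathfrak g_1)$), and put $v\triangleright u=(\mathrm{id}\otimes\varepsilon)\Psi(v\otimes u)$, $v\triangleleft u=(\varepsilon\otimes\mathrm{id})\Psi(v\otimes u)$. **$R(\mathfrak g_2)$** is the commutative Hopf algebra of linear functionals on $U(\mathfrak g_2)$ whose kernel contains a finite codimensional ideal (product dual to the coproduct, coproduct dual to the product, of $U(\mathfrak g_2)$). It is a $\mathfrak g_1$-Hopf algebra with the action $(X\triangleright f)(v)=f(v\triangleleft X)$ and the coaction $\mathfrak g_1\to\mathfrak g_1\otimes R(\mathfrak g_2)$, $X\mapsto X_{<0>}\otimes X_{<1>}$, determined by $v\triangleright X=X_{<1>}(v)X_{<0>}$ for $v\in U(\mathfrak g_2)$. **Induced module.** A left $\mathfrak g_1$-module and right $R(\mathfrak g_2)$-comodule $M$ is an induced $(\mathfrak g_1,R(\mathfrak g_2))$-module if $\blacktriangledown_M(X\cdot m)=X_{<0>}\cdot m_{<0>}\otimes X_{<1>}m_{<1>}+m_{<0>}\otimes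 X\triangleright m_{<1>}$ for all $X\in\mathfrak g_1$, $m\in M$. *)

(* Defs.v *)
From HB Require Import structures.
From mathcomp Require Import all_boot all_order all_algebra.
From mathcomp Require Import generic_quotient.
From mathcomp Require Import boolp classical_sets functions.
From mathcomp Require Import reals.
From mathcomp Require Import complex ring.

Set Implicit Arguments.
Unset Strict Implicit.
Unset Printing Implicit Defensive.

Import GRing.Theory.
Local Open Scope ring_scope.
Local Open Scope quotient_scope.

HB.mixin Record hasLieBracket (F : fieldType) V of Vector F V := {
  lie : V -> V -> V;
  lieDl : forall x y z : V, lie (x + y) z = lie x z + lie y z;
  lieZl : forall (c : F) (x y : V), lie (c *: x) y = c *: lie x y;
  liexx : forall x : V, lie x x = 0;
  lieDr : forall x y z : V, lie x (y + z) = lie x y + lie x z;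
  lieZr : forall (c : F) (x y : V), lie x (c *: y) = c *: lie x y;
  lieJ : forall x y z : V,
    lie x (lie y z) + lie y (lie z x) + lie z (lie x y) = 0 }.

#[short(type="lieAlgType")]
HB.structure Definition LieAlgebra (F : fieldType) :=
  { V of Vector F V & hasLieBracket F V }.

Arguments lie {F s} : rename.

Definition bilinear_map (F : fieldType) (V W Z : lmodType F)
    (b : V -> W -> Z) : Prop :=
  (forall w, linear (b^~ w)) /\ (forall v, linear (b v)).

Section LinearMaps.
Variables (F : fieldType) (V W : lmodType F) (f : V -> W).
Hypothesis f_linear : linear f.

Lemma linear_mapD x y : f (x + y) = f x + f y.
Proof. by have := f_linear 1 x y; rewrite !scale1r. Qed.

Lemma linear_map0 : f 0 = 0.
Proof. by apply: (addIr (f 0)); rewrite -linear_mapD !add0r. Qed.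

Lemma linear_mapZ c x : f (c *: x) = c *: f x.
Proof. by have := f_linear c x 0; rewrite !addr0 linear_map0 addr0. Qed.

Lemma linear_mapN x : f (- x) = - f x.
Proof. by rewrite -scaleN1r linear_mapZ scaleN1r. Qed.

Lemma linear_mapB x y : f (x - y) = f x - f y.
Proof. by rewrite linear_mapD linear_mapN. Qed.

End LinearMaps.

Section LieModules.
Variables (F : fieldType) (g : lieAlgType F).

Definition is_lie_hom (A : algType F) (f : g -> A) : Prop :=
  linear f /\ forall x y, f (lie x y) = f x * f y - f y * f x.

Definition is_lie_module (M : lmodType F) (act : g -> M -> M) : Prop :=
  bilinear_map act /\
  forall x y m, act (lie x y) m = act x (act y m) - act y (act x m).

(* every vector lies in a finite dimensional submodule *)
Definition locally_finite (M : lmodType F) (act : g -> M -> M) : Prop :=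
  forall m : M, exists (n : nat) (e : 'I_n -> M),
    let span := [set p : M | exists c : 'I_n -> F, p = \sum_i c i *: e i]%classic in
    span m /\ forall x p, span p -> span (act x p).

End LieModules.

Section Tensor.
Variables (F : fieldType) (V W : lmodType F).

(* V (x) W is the F-module with generators the pure tensors and relations
   the bilinearity of (v, w) |-> v (x) w *)
Inductive tens_term : Type :=
  | TZero
  | TPure of V & W
  | TAdd of tens_term & tens_term
  | TScale of F & tens_term.

Inductive tens_rel : tens_term -> tens_term -> Prop :=
  | tr_refl s : tens_rel s s
  | tr_sym s t : tens_rel s t -> tens_rel t s
  | tr_trans s t u : tens_rel s t -> tens_rel t u -> tens_rel s u
  | tr_add s s' t t' : tens_rel s s' -> tens_rel t t' ->
      tens_rel (TAdd s t) (TAdd s' t')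
  | tr_scale c s s' : tens_rel s s' -> tens_rel (TScale c s) (TScale c s')
  | tr_addA s t u : tens_rel (TAdd s (TAdd t u)) (TAdd (TAdd s t) u)
  | tr_addC s t : tens_rel (TAdd s t) (TAdd t s)
  | tr_add0 s : tens_rel (TAdd TZero s) s
  | tr_addN s : tens_rel (TAdd (TScale (-1) s) s) TZero
  | tr_scaleA c d s : tens_rel (TScale c (TScale d s)) (TScale (c * d) s)
  | tr_scale1 s : tens_rel (TScale 1 s) s
  | tr_scaleDr c s t :
      tens_rel (TScale c (TAdd s t)) (TAdd (TScale c s) (TScale c t))
  | tr_scaleDl c d s :
      tens_rel (TScale (c + d) s) (TAdd (TScale c s) (TScale d s))
  | tr_pureDl v v' w : tens_rel (TPure (v + v') w) (TAdd (TPure v w) (TPure v' w))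
  | tr_pureDr v w w' : tens_rel (TPure v (w + w')) (TAdd (TPure v w) (TPure v w'))
  | tr_pureZl c v w : tens_rel (TPure (c *: v) w) (TScale c (TPure v w))
  | tr_pureZr c v w : tens_rel (TPure v (c *: w)) (TScale c (TPure v w)).

HB.instance Definition _ := gen_eqMixin tens_term.
HB.instance Definition _ := gen_choiceMixin tens_term.

Definition tens_eqb (s t : tens_term) : bool := `[< tens_rel s t >].

Lemma tens_eqb_equiv : equiv_class_of tens_eqb.
Proof.
split=> [s|s t|t s u].
- by apply/asboolP; apply: tr_refl.
- by apply/asboolP/asboolP => h; apply: tr_sym.
- by move=> /asboolP h1 /asboolP h2; apply/asboolP; apply: tr_trans h1 h2.
Qed.

Canonical tens_equiv := EquivRelPack tens_eqb_equiv.

Definition tensor := {eq_quot tens_equiv}.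
HB.instance Definition _ := Choice.on tensor.
HB.instance Definition _ := Quotient.on tensor.

Definition tens_class (s : tens_term) : tensor := \pi_tensor s.

Lemma tens_classP s t : tens_class s = tens_class t <-> tens_rel s t.
Proof.
split=> [/eqP|h]; first by rewrite /tens_class piE => /asboolP.
by apply/eqP; rewrite /tens_class piE; apply/asboolP.
Qed.

Lemma tens_classK (x : tensor) : tens_class (repr x) = x.
Proof. exact: reprK. Qed.

Lemma repr_tens_class s : tens_rel (repr (tens_class s)) s.
Proof. by apply/tens_classP; rewrite tens_classK. Qed.

Let tzero := tens_class TZero.
Let tadd (x y : tensor) := tens_class (TAdd (repr x) (repr y)).
Let tscale (c : F) (x : tensor) := tens_class (TScale c (repr x)).
Let topp := tscale (-1).

Let taddE s t : tadd (tens_class s) (tens_class t) = tens_class (TAdd s t).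
Proof. by apply/tens_classP; apply: tr_add; apply: repr_tens_class. Qed.

Let tscaleE c s : tscale c (tens_class s) = tens_class (TScale c s).
Proof. by apply/tens_classP; apply: tr_scale; apply: repr_tens_class. Qed.

Let taddA : associative tadd.
Proof.
move=> x y z; rewrite -(tens_classK x) -(tens_classK y) -(tens_classK z) !taddE.
by apply/tens_classP; apply: tr_addA.
Qed.

Let taddC : commutative tadd.
Proof.
move=> x y; rewrite -(tens_classK x) -(tens_classK y) !taddE.
by apply/tens_classP; apply: tr_addC.
Qed.

Let tadd0 : left_id tzero tadd.
Proof.
by move=> x; rewrite -(tens_classK x) taddE; apply/tens_classP; apply: tr_add0.
Qed.

Let taddN : left_inverse tzero topp tadd.
Proof.
move=> x; rewrite -(tens_classK x) /topp tscaleE taddE.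
by apply/tens_classP; apply: tr_addN.
Qed.

HB.instance Definition _ := GRing.isZmodule.Build tensor taddA taddC tadd0 taddN.

Let tscaleA c d x : tscale c (tscale d x) = tscale (c * d) x.
Proof.
by rewrite -(tens_classK x) !tscaleE; apply/tens_classP; apply: tr_scaleA.
Qed.

Let tscale1 : left_id 1 tscale.
Proof.
by move=> x; rewrite -(tens_classK x) !tscaleE; apply/tens_classP; apply: tr_scale1.
Qed.

Let tscaleDr : right_distributive tscale +%R.
Proof.
move=> c x y; change (tscale c (tadd x y) = tadd (tscale c x) (tscale c y)).
rewrite -(tens_classK x) -(tens_classK y) !(taddE, tscaleE).
by apply/tens_classP; apply: tr_scaleDr.
Qed.

Let tscaleDl x : {morph tscale^~ x : c d / c + d}.
Proof.
move=> c d; change (tscale (c + d) x = tadd (tscale c x) (tscale d x)).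
rewrite -(tens_classK x) !(taddE, tscaleE).
by apply/tens_classP; apply: tr_scaleDl.
Qed.

HB.instance Definition _ := GRing.Zmodule_isLmodule.Build F tensor
  tscaleA tscale1 tscaleDr tscaleDl.

Definition tens (v : V) (w : W) : tensor := tens_class (TPure v w).

Lemma tens_class0 : tens_class TZero = 0.
Proof. by []. Qed.

Lemma tens_classD s t : tens_class (TAdd s t) = tens_class s + tens_class t.
Proof. by rewrite -taddE. Qed.

Lemma tens_classZ c s : tens_class (TScale c s) = c *: tens_class s.
Proof. by rewrite -tscaleE. Qed.

Lemma tens_bilinear : bilinear_map tens.
Proof.
split=> [w c v v'|v c w w']; rewrite /tens /= -tens_classZ -tens_classD;
  apply/tens_classP.
- apply: tr_trans (tr_pureDl _ _ _) _.
  by apply: tr_add; [exact: tr_pureZl|exact: tr_refl].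
- apply: tr_trans (tr_pureDr _ _ _) _.
  by apply: tr_add; [exact: tr_pureZr|exact: tr_refl].
Qed.

Lemma tens_ind (P : tensor -> Prop) :
  P 0 -> (forall v w, P (tens v w)) -> (forall x y, P x -> P y -> P (x + y)) ->
  (forall c x, P x -> P (c *: x)) -> forall x, P x.
Proof.
move=> P0 Pt PD PZ x; rewrite -(tens_classK x).
elim: (repr x) => [|v w|s ihs t iht|c s ihs].
- exact: P0.
- exact: Pt.
- by rewrite tens_classD; apply: PD.
- by rewrite tens_classZ; apply: PZ.
Qed.

Section Lift.
Variables (Z : lmodType F) (b : V -> W -> Z).

Fixpoint tens_eval (s : tens_term) : Z :=
  match s with
  | TZero => 0
  | TPure v w => b v w
  | TAdd s t => tens_eval s + tens_eval t
  | TScale c s => c *: tens_eval s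
  end.

(* the linear map v (x) w |-> b v w induced by a bilinear map b
   (lemmas tlift_linear and tlift_tens); meaningless if b is not bilinear *)
Definition tlift (x : tensor) : Z := tens_eval (repr x).

Hypothesis b_bilin : bilinear_map b.

Lemma tens_eval_rel s t : tens_rel s t -> tens_eval s = tens_eval t.
Proof.
have [bl br] := b_bilin.
elim=> //= {s t}.
- by move=> s t u _ -> _ ->.
- by move=> s s' t t' _ -> _ ->.
- by move=> c s s' _ ->.
- by move=> s t u; rewrite addrA.
- by move=> s t; rewrite addrC.
- by move=> s; rewrite add0r.
- by move=> s; rewrite scaleN1r addNr.
- by move=> c d s; rewrite scalerA.
- by move=> s; rewrite scale1r.
- by move=> c s t; rewrite scalerDr.
- by move=> c d s; rewrite scalerDl.
- by move=> v v' w; rewrite (linear_mapD (bl w)).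
- by move=> v w w'; rewrite (linear_mapD (br v)).
- by move=> c v w; rewrite (linear_mapZ (bl w)).
- by move=> c v w; rewrite (linear_mapZ (br v)).
Qed.

Lemma tlift_class s : tlift (tens_class s) = tens_eval s.
Proof. by apply: tens_eval_rel; apply: repr_tens_class. Qed.

Lemma tlift_tens v w : tlift (tens v w) = b v w.
Proof. exact: tlift_class. Qed.

Lemma tlift_linear : linear tlift.
Proof.
move=> c x y; rewrite -(tens_classK x) -(tens_classK y).
by rewrite -tens_classZ -tens_classD !tlift_class.
Qed.

End Lift.

End Tensor.

Definition tmap (F : fieldType) (V V' W W' : lmodType F)
    (f : V -> V') (h : W -> W') : tensor V W -> tensor V' W' :=
  tlift (fun v w => tens (f v) (h w)).

Definition tassoc (F : fieldType) (V W Z : lmodType F) :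
    tensor (tensor V W) Z -> tensor V (tensor W Z) :=
  tlift (fun x z => tlift (fun v w => tens v (tens w z)) x).

Section Enveloping.
Variables (F : fieldType) (g : lieAlgType F).

(* U(g) is the unital associative algebra with generators the x in g and
   relations: x |-> UGen x is linear and [x, y] = x y - y x *)
Inductive env_term : Type :=
  | UScal of F
  | UGen of g
  | UAdd of env_term & env_term
  | UMul of env_term & env_term.

Inductive env_rel : env_term -> env_term -> Prop :=
  | er_refl s : env_rel s s
  | er_sym s t : env_rel s t -> env_rel t s
  | er_trans s t u : env_rel s t -> env_rel t u -> env_rel s u
  | er_add s s' t t' : env_rel s s' -> env_rel t t' ->
      env_rel (UAdd s t) (UAdd s' t')
  | er_mul s s' t t' : env_rel s s' -> env_rel t t' ->
      env_rel (UMul s t) (UMul s' t')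
  | er_addA s t u : env_rel (UAdd s (UAdd t u)) (UAdd (UAdd s t) u)
  | er_addC s t : env_rel (UAdd s t) (UAdd t s)
  | er_add0 s : env_rel (UAdd (UScal 0) s) s
  | er_addN s : env_rel (UAdd (UMul (UScal (-1)) s) s) (UScal 0)
  | er_mulA s t u : env_rel (UMul s (UMul t u)) (UMul (UMul s t) u)
  | er_mul1l s : env_rel (UMul (UScal 1) s) s
  | er_mulDl s t u : env_rel (UMul (UAdd s t) u) (UAdd (UMul s u) (UMul t u))
  | er_mulDr s t u : env_rel (UMul s (UAdd t u)) (UAdd (UMul s t) (UMul s u))
  | er_scalD c d : env_rel (UScal (c + d)) (UAdd (UScal c) (UScal d))
  | er_scalM c d : env_rel (UScal (c * d)) (UMul (UScal c) (UScal d))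
  | er_scalC c s : env_rel (UMul (UScal c) s) (UMul s (UScal c))
  | er_genD x y : env_rel (UGen (x + y)) (UAdd (UGen x) (UGen y))
  | er_genZ c x : env_rel (UGen (c *: x)) (UMul (UScal c) (UGen x))
  | er_lie x y : env_rel (UGen (lie x y))
      (UAdd (UMul (UGen x) (UGen y))
            (UMul (UScal (-1)) (UMul (UGen y) (UGen x)))).

HB.instance Definition _ := gen_eqMixin env_term.
HB.instance Definition _ := gen_choiceMixin env_term.

Definition env_eqb (s t : env_term) : bool := `[< env_rel s t >].

Lemma env_eqb_equiv : equiv_class_of env_eqb.
Proof.
split=> [s|s t|t s u].
- by apply/asboolP; apply: er_refl.
- by apply/asboolP/asboolP => h; apply: er_sym.
- by move=> /asboolP h1 /asboolP h2; apply/asboolP; apply: er_trans h1 h2.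
Qed.

Canonical env_equiv := EquivRelPack env_eqb_equiv.

Definition uenv := {eq_quot env_equiv}.
HB.instance Definition _ := Choice.on uenv.
HB.instance Definition _ := Quotient.on uenv.

Definition env_class (s : env_term) : uenv := \pi_uenv s.

Lemma env_classP s t : env_class s = env_class t <-> env_rel s t.
Proof.
split=> [/eqP|h]; first by rewrite /env_class piE => /asboolP.
by apply/eqP; rewrite /env_class piE; apply/asboolP.
Qed.

Lemma env_classK (x : uenv) : env_class (repr x) = x.
Proof. exact: reprK. Qed.

Lemma repr_env_class s : env_rel (repr (env_class s)) s.
Proof. by apply/env_classP; rewrite env_classK. Qed.

Let uscal c := env_class (UScal c).
Let uadd (x y : uenv) := env_class (UAdd (repr x) (repr y)).
Let umul (x y : uenv) := env_class (UMul (repr x) (repr y)).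
Let uopp := umul (uscal (-1)).

Let uaddE s t : uadd (env_class s) (env_class t) = env_class (UAdd s t).
Proof. by apply/env_classP; apply: er_add; apply: repr_env_class. Qed.

Let umulE s t : umul (env_class s) (env_class t) = env_class (UMul s t).
Proof. by apply/env_classP; apply: er_mul; apply: repr_env_class. Qed.

Let uaddA : associative uadd.
Proof.
move=> x y z; rewrite -(env_classK x) -(env_classK y) -(env_classK z) !uaddE.
by apply/env_classP; apply: er_addA.
Qed.

Let uaddC : commutative uadd.
Proof.
move=> x y; rewrite -(env_classK x) -(env_classK y) !uaddE.
by apply/env_classP; apply: er_addC.
Qed.

Let uadd0 : left_id (uscal 0) uadd.
Proof.
by move=> x; rewrite -(env_classK x) uaddE; apply/env_classP; apply: er_add0.
Qed.

Let uaddN : left_inverse (uscal 0) uopp uadd.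
Proof.
move=> x; rewrite -(env_classK x) /uopp umulE uaddE.
by apply/env_classP; apply: er_addN.
Qed.

HB.instance Definition _ := GRing.isZmodule.Build uenv uaddA uaddC uadd0 uaddN.

Let umulA : associative umul.
Proof.
move=> x y z; rewrite -(env_classK x) -(env_classK y) -(env_classK z) !umulE.
by apply/env_classP; apply: er_mulA.
Qed.

Let umul1l : left_id (uscal 1) umul.
Proof.
by move=> x; rewrite -(env_classK x) umulE; apply/env_classP; apply: er_mul1l.
Qed.

Let umul1r : right_id (uscal 1) umul.
Proof.
move=> x; rewrite -[RHS]umul1l -(env_classK x) !umulE.
by apply/env_classP; apply: er_sym; apply: er_scalC.
Qed.

Let umulDl : left_distributive umul +%R.
Proof.
move=> x y z; change (umul (uadd x y) z = uadd (umul x z) (umul y z)).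
rewrite -(env_classK x) -(env_classK y) -(env_classK z) !(umulE, uaddE).
by apply/env_classP; apply: er_mulDl.
Qed.

Let umulDr : right_distributive umul +%R.
Proof.
move=> x y z; change (umul x (uadd y z) = uadd (umul x y) (umul x z)).
rewrite -(env_classK x) -(env_classK y) -(env_classK z) !(umulE, uaddE).
by apply/env_classP; apply: er_mulDr.
Qed.

HB.instance Definition _ :=
  GRing.Zmodule_isPzRing.Build uenv umulA umul1l umul1r umulDl umulDr.

Let uscale c (x : uenv) : uenv := uscal c * x.

Let uscalM c d : uscal (c * d) = uscal c * uscal d.
Proof.
by change (uscal (c * d) = umul (uscal c) (uscal d)); rewrite umulE;
   apply/env_classP; apply: er_scalM.
Qed.

Let uscalD c d : uscal (c + d) = uscal c + uscal d.
Proof.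
by change (uscal (c + d) = uadd (uscal c) (uscal d)); rewrite uaddE;
   apply/env_classP; apply: er_scalD.
Qed.

Let uscaleA c d x : uscale c (uscale d x) = uscale (c * d) x.
Proof. by rewrite /uscale mulrA uscalM. Qed.

Let uscale1 : left_id 1 uscale.
Proof. by move=> x; rewrite /uscale (mul1r x). Qed.

Let uscaleDr : right_distributive uscale +%R.
Proof. by move=> c x y; rewrite /uscale mulrDr. Qed.

Let uscaleDl x : {morph uscale^~ x : c d / c + d}.
Proof. by move=> c d; rewrite /uscale uscalD mulrDl. Qed.

HB.instance Definition _ := GRing.Zmodule_isLmodule.Build F uenv
  uscaleA uscale1 uscaleDr uscaleDl.

Definition uinj (x : g) : uenv := env_class (UGen x).

Lemma env_classD s t : env_class (UAdd s t) = env_class s + env_class t.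
Proof. by rewrite -uaddE. Qed.

Lemma env_classM s t : env_class (UMul s t) = env_class s * env_class t.
Proof. by rewrite -umulE. Qed.

Lemma env_classZ c s : env_class (UMul (UScal c) s) = c *: env_class s.
Proof. exact: env_classM. Qed.

Lemma env_classC c : env_class (UScal c) = c *: (1 : uenv).
Proof. by change (uscal c = uscal c * 1); rewrite mulr1. Qed.

Section Lift.
Variables (A : algType F) (f : g -> A).

Fixpoint env_eval (s : env_term) : A :=
  match s with
  | UScal c => c%:A
  | UGen x => f x
  | UAdd s t => env_eval s + env_eval t
  | UMul s t => env_eval s * env_eval t
  end.

(* the algebra morphism U(g) -> A extending a Lie morphism f : g -> A
   (lemmas ulift_linear, ulift1, uliftM, ulift_uinj); meaningless otherwise *)
Definition ulift (u : uenv) : A := env_eval (repr u).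

Hypothesis f_lie : is_lie_hom f.

Lemma env_eval_rel s t : env_rel s t -> env_eval s = env_eval t.
Proof.
have [flin fl] := f_lie.
elim=> //= {s t}.
- by move=> s t u _ -> _ ->.
- by move=> s s' t t' _ -> _ ->.
- by move=> s s' t t' _ -> _ ->.
- by move=> s t u; rewrite addrA.
- by move=> s t; rewrite addrC.
- by move=> s; rewrite scale0r add0r.
- by move=> s; rewrite scaleN1r scale0r mulN1r addNr.
- by move=> s t u; rewrite mulrA.
- by move=> s; rewrite scale1r mul1r.
- by move=> s t u; rewrite mulrDl.
- by move=> s t u; rewrite mulrDr.
- by move=> c d; rewrite scalerDl.
- by move=> c d; rewrite -scalerAl mul1r scalerA.
- by move=> c s; rewrite -scalerAl -scalerAr mulr1 mul1r.
- by move=> x y; rewrite (linear_mapD flin).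
- by move=> c x; rewrite (linear_mapZ flin) -scalerAl mul1r.
- by move=> x y; rewrite fl scaleN1r mulN1r.
Qed.

Lemma ulift_class s : ulift (env_class s) = env_eval s.
Proof. by apply: env_eval_rel; apply: repr_env_class. Qed.

Lemma ulift_uinj x : ulift (uinj x) = f x.
Proof. exact: ulift_class. Qed.

Lemma ulift1 : ulift 1 = 1.
Proof. by rewrite ulift_class /= scale1r. Qed.

Lemma uliftM u v : ulift (u * v) = ulift u * ulift v.
Proof.
by rewrite -(env_classK u) -(env_classK v) -env_classM !ulift_class.
Qed.

Lemma ulift_linear : linear ulift.
Proof.
move=> c u v; rewrite -(env_classK u) -(env_classK v).
by rewrite -env_classZ -env_classD !ulift_class /= -scalerAl mul1r.
Qed.

End Lift.

Definition ucounit : uenv -> F^o := ulift (fun _ : g => 0 : F^o).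

Lemma zero_lie_hom : is_lie_hom (fun _ : g => 0 : F^o).
Proof.
split=> [c x y|x y]; first by rewrite scaler0 addr0.
by rewrite mulr0 subrr.
Qed.

Lemma ucounit0 : ucounit 0 = 0.
Proof. exact: linear_map0 (ulift_linear zero_lie_hom). Qed.

Let uenv1_neq0 : (1 : uenv) != 0.
Proof.
apply/eqP => h; have := ucounit0; rewrite -h /ucounit (ulift1 zero_lie_hom).
by move/eqP; rewrite oner_eq0.
Qed.

HB.instance Definition _ := GRing.PzSemiRing_isNonZero.Build uenv uenv1_neq0.

Let uscaleAl c (x y : uenv) : c *: (x * y) = (c *: x) * y.
Proof. by change (uscal c * (x * y) = uscal c * x * y); rewrite mulrA. Qed.

HB.instance Definition _ := GRing.Lmodule_isLalgebra.Build F uenv uscaleAl.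

Let uscaleAr c (x y : uenv) : c *: (x * y) = x * (c *: y).
Proof.
change (uscal c * (x * y) = x * (uscal c * y)).
rewrite !mulrA; congr (_ * y); change (umul (uscal c) x = umul x (uscal c)).
by rewrite -(env_classK x) !umulE; apply/env_classP; apply: er_scalC.
Qed.

HB.instance Definition _ := GRing.Lalgebra_isAlgebra.Build F uenv uscaleAr.

Lemma uinj_lie_hom : is_lie_hom (uinj : g -> uenv).
Proof.
split=> [c x y|x y].
- change (uinj (c *: x + y) = uscal c * uinj x + uinj y).
  rewrite -[uscal c * _]env_classM -env_classD.
  apply/env_classP; apply: er_trans (er_genD _ _) _.
  by apply: er_add; [exact: er_genZ|exact: er_refl].
- rewrite -[- _]scaleN1r.
  change (uinj (lie x y) = uinj x * uinj y + uscal (-1) * (uinj y * uinj x)).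
  rewrite -[uinj x * _]env_classM -[uinj y * _]env_classM -[uscal _ * _]env_classM.
  by rewrite -env_classD; apply/env_classP; apply: er_lie.
Qed.

Lemma uenv_ind (P : uenv -> Prop) :
  (forall c : F, P (c *: 1)) -> (forall x, P (uinj x)) ->
  (forall u v, P u -> P v -> P (u + v)) ->
  (forall u v, P u -> P v -> P (u * v)) -> forall u, P u.
Proof.
move=> PC Pg PD PM u; rewrite -(env_classK u).
elim: (repr u) => [c|x|s ihs t iht|s ihs t iht].
- by rewrite env_classC.
- exact: Pg.
- by rewrite env_classD; apply: PD.
- by rewrite env_classM; apply: PM.
Qed.

Section Action.
Variables (M : lmodType F) (act : g -> M -> M).

Fixpoint env_act (s : env_term) (m : M) : M :=
  match s with
  | UScal c => c *: m
  | UGen x => act x m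
  | UAdd s t => env_act s m + env_act t m
  | UMul s t => env_act s (env_act t m)
  end.

(* the U(g)-module structure extending a g-module structure act
   (lemmas uact_bilinear, uact1, uactM, uact_uinj); meaningless otherwise *)
Definition uact (u : uenv) (m : M) : M := env_act (repr u) m.

Hypothesis act_mod : is_lie_module act.

Lemma env_act_linear s : linear (env_act s).
Proof.
have [[_ ar] _] := act_mod.
elim: s => [c|x|s ihs t iht|s ihs t iht] d m p /=.
- by rewrite scalerDr !scalerA mulrC.
- exact: ar.
- by rewrite ihs iht scalerDr addrACA.
- by rewrite iht ihs.
Qed.

Lemma env_act_rel s t : env_rel s t -> env_act s =1 env_act t.
Proof.
have [[al ar] alie] := act_mod.
have eL := env_act_linear.
elim=> //= {s t}.
- by move=> s t _ h m; rewrite h.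
- by move=> s t u _ h1 _ h2 m; rewrite h1 h2.
- by move=> s s' t t' _ h1 _ h2 m; rewrite h1 h2.
- by move=> s s' t t' _ h1 _ h2 m; rewrite h2 h1.
- by move=> s t u m; rewrite addrA.
- by move=> s t m; rewrite addrC.
- by move=> s m; rewrite scale0r add0r.
- by move=> s m; rewrite scaleN1r scale0r addNr.
- by move=> s m; rewrite scale1r.
- by move=> s t u m; rewrite (linear_mapD (eL _)).
- by move=> c d m; rewrite scalerDl.
- by move=> c d m; rewrite scalerA.
- by move=> c s m; rewrite (linear_mapZ (eL _)).
- by move=> x y m; rewrite (linear_mapD (al m)).
- by move=> c x m; rewrite (linear_mapZ (al m)).
- by move=> x y m; rewrite alie scaleN1r.
Qed.

Lemma uact_class s m : uact (env_class s) m = env_act s m.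
Proof. by apply: env_act_rel; apply: repr_env_class. Qed.

Lemma uact_uinj x m : uact (uinj x) m = act x m.
Proof. exact: uact_class. Qed.

Lemma uact1 m : uact 1 m = m.
Proof. by rewrite uact_class /= scale1r. Qed.

Lemma uactM u v m : uact (u * v) m = uact u (uact v m).
Proof.
by rewrite -(env_classK u) -(env_classK v) -env_classM !uact_class.
Qed.

Lemma uact_bilinear : bilinear_map uact.
Proof.
split=> [m c u v|u c m p]; last exact: env_act_linear.
rewrite -(env_classK u) -(env_classK v).
by rewrite -env_classZ -env_classD !uact_class.
Qed.

End Action.

End Enveloping.

Arguments uinj {F g} x.
Arguments ucounit {F g} u.

Section TensorProductAlgebra.
Variables (F : fieldType) (A B : algType F).

Definition tmul (x y : tensor A B) : tensor A B :=
  tlift (fun a b => tlift (fun a' b' => tens (a * a') (b * b')) y) x.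

Let inner_bilin (a : A) (b : B) :
  bilinear_map (fun a' b' => tens (a * a') (b * b')).
Proof.
have [tl tr] := tens_bilinear A B.
by split=> [b' c u v|a' c u v]; rewrite mulrDr -scalerAr; [apply: tl|apply: tr].
Qed.

Let outer_bilin (y : tensor A B) :
  bilinear_map (fun a b => tlift (fun a' b' => tens (a * a') (b * b')) y).
Proof.
have [tl tr] := tens_bilinear A B.
split=> [b c u v|a c u v].
- elim/tens_ind: y => [|a' b'|x y ihx ihy|d x ihx].
  + by rewrite !(linear_map0 (tlift_linear (inner_bilin _ _))) scaler0 addr0.
  + by rewrite !tlift_tens // mulrDl -scalerAl tl.
  + rewrite !(linear_mapD (tlift_linear (inner_bilin _ _))) ihx ihy.
    by rewrite scalerDr addrACA.
  + rewrite !(linear_mapZ (tlift_linear (inner_bilin _ _))) ihx.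
    by rewrite scalerDr !scalerA mulrC.
- elim/tens_ind: y => [|a' b'|x y ihx ihy|d x ihx].
  + by rewrite !(linear_map0 (tlift_linear (inner_bilin _ _))) scaler0 addr0.
  + by rewrite !tlift_tens // mulrDl -scalerAl tr.
  + rewrite !(linear_mapD (tlift_linear (inner_bilin _ _))) ihx ihy.
    by rewrite scalerDr addrACA.
  + rewrite !(linear_mapZ (tlift_linear (inner_bilin _ _))) ihx.
    by rewrite scalerDr !scalerA mulrC.
Qed.

Lemma tmul_tens a b a' b' :
  tmul (tens a b) (tens a' b') = tens (a * a') (b * b').
Proof. by rewrite /tmul !tlift_tens. Qed.

Lemma tmul_linearl y : linear (tmul^~ y).
Proof. exact: tlift_linear. Qed.

Lemma tmul_linearr x : linear (tmul x).
Proof.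
move=> c y z; elim/tens_ind: x => [|a b|x x' ihx ihx'|d x ihx].
- by rewrite !(linear_map0 (tmul_linearl _)) scaler0 addr0.
- by rewrite /tmul !(tlift_tens (outer_bilin _)) tlift_linear.
- by rewrite !(linear_mapD (tmul_linearl _)) ihx ihx' scalerDr addrACA.
- by rewrite !(linear_mapZ (tmul_linearl _)) ihx scalerDr !scalerA mulrC.
Qed.

Lemma tmulDl : left_distributive tmul +%R.
Proof. by move=> x y z; rewrite (linear_mapD (tmul_linearl z)). Qed.

Lemma tmulDr : right_distributive tmul +%R.
Proof. by move=> x y z; rewrite (linear_mapD (tmul_linearr x)). Qed.

Lemma tmulZl c x y : c *: tmul x y = tmul (c *: x) y.
Proof. by rewrite (linear_mapZ (tmul_linearl y)). Qed.

Lemma tmulZr c x y : c *: tmul x y = tmul x (c *: y).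
Proof. by rewrite (linear_mapZ (tmul_linearr x)). Qed.

Lemma tmul0l x : tmul 0 x = 0.
Proof. exact: linear_map0 (tmul_linearl x). Qed.

Lemma tmul0r x : tmul x 0 = 0.
Proof. exact: linear_map0 (tmul_linearr x). Qed.

Lemma tmulA : associative tmul.
Proof.
move=> x y z; elim/tens_ind: x => [|a b|x x' ihx ihx'|d x ihx].
- by rewrite !tmul0l.
- elim/tens_ind: y => [|a' b'|y y' ihy ihy'|d y ihy].
  + by rewrite !(tmul0l, tmul0r).
  + elim/tens_ind: z => [|a'' b''|z z' ihz ihz'|d z ihz].
    * by rewrite !tmul0r.
    * by rewrite !tmul_tens !mulrA.
    * by rewrite !tmulDr ihz ihz'.
    * by rewrite -!tmulZr ihz.
  + by rewrite !(tmulDl, tmulDr) ihy ihy'.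
  + by rewrite -!(tmulZl, tmulZr) ihy.
- by rewrite !tmulDl ihx ihx'.
- by rewrite -!tmulZl ihx.
Qed.

Lemma tmul1l : left_id (tens 1 1) tmul.
Proof.
elim/tens_ind => [|a b|x y ihx ihy|c x ihx].
- by rewrite tmul0r.
- by rewrite tmul_tens !mul1r.
- by rewrite tmulDr ihx ihy.
- by rewrite -tmulZr ihx.
Qed.

Lemma tmul1r : right_id (tens 1 1) tmul.
Proof.
elim/tens_ind => [|a b|x y ihx ihy|c x ihx].
- by rewrite tmul0l.
- by rewrite tmul_tens !mulr1.
- by rewrite tmulDl ihx ihy.
- by rewrite -tmulZl ihx.
Qed.

End TensorProductAlgebra.

(* The algebra structure is declared on U(g) (x) U(h) only, where 1 <> 0 is
   witnessed by the counits. *)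
Section TensorEnveloping.
Variables (F : fieldType) (g h : lieAlgType F).
Local Notation T := (tensor (uenv g) (uenv h)).

HB.instance Definition _ := GRing.Zmodule_isPzRing.Build T
  (@tmulA F (uenv g) (uenv h)) (@tmul1l F (uenv g) (uenv h))
  (@tmul1r F (uenv g) (uenv h)) (@tmulDl F (uenv g) (uenv h))
  (@tmulDr F (uenv g) (uenv h)).

Let tens11_neq0 : (1 : T) != 0.
Proof.
pose b (u : uenv g) (v : uenv h) : F^o := ucounit u * ucounit v.
have b_bilin : bilinear_map b.
  split=> [w c u v|w c u v]; rewrite /b /ucounit.
  - by rewrite ulift_linear ?mulrDl -?scalerAl //; apply: zero_lie_hom.
  - by rewrite ulift_linear ?mulrDr -?scalerAr //; apply: zero_lie_hom.
apply/eqP => t0; have := tlift_tens b_bilin 1 1.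
rewrite -[tens 1 1]/(1 : T) t0 (linear_map0 (tlift_linear b_bilin)) /b.
rewrite /ucounit !ulift1; try exact: zero_lie_hom.
by rewrite mulr1 => /esym/eqP; rewrite oner_eq0.
Qed.

HB.instance Definition _ := GRing.PzSemiRing_isNonZero.Build T tens11_neq0.
HB.instance Definition _ := GRing.Lmodule_isLalgebra.Build F T
  (@tmulZl F (uenv g) (uenv h)).
HB.instance Definition _ := GRing.Lalgebra_isAlgebra.Build F T
  (@tmulZr F (uenv g) (uenv h)).

End TensorEnveloping.

Definition ucoprod (F : fieldType) (g : lieAlgType F) :
    uenv g -> tensor (uenv g) (uenv g) :=
  ulift (fun x => tens (uinj x) 1 + tens 1 (uinj x)).

Lemma ucoprod_lie_hom (F : fieldType) (g : lieAlgType F) :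
  is_lie_hom (fun x : g => tens (uinj x) 1 + tens 1 (uinj x)
    : tensor (uenv g) (uenv g)).
Proof.
have [tl tr] := tens_bilinear (uenv g) (uenv g).
have [ul ulie] := uinj_lie_hom g.
split=> [c x y|x y].
  by rewrite ul tl tr scalerDr addrACA.
have mE (a b a' b' : uenv g) : tens a b * tens a' b' = tens (a * a') (b * b').
  exact: tmul_tens.
rewrite !(mulrDl, mulrDr) !mE !mul1r !mulr1 ulie.
have tBl (u v w : uenv g) : tens (u - v) w = tens u w - tens v w.
  by rewrite -scaleN1r addrC tl scaleN1r addrC.
have tBr (u v w : uenv g) : tens w (u - v) = tens w u - tens w v.
  by rewrite -scaleN1r addrC tr scaleN1r addrC.
rewrite tBl tBr; set a := tens (_ * _) 1; set a' := tens (_ * _) 1.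
set d := tens 1 (_ * _); set d' := tens 1 (_ * _).
set e := tens (uinj x) _; set e' := tens (uinj y) _.
rewrite (addrC e' d) (addrACA a e) (addrC e d') (addrACA a' e') (addrC e' e).
by rewrite [in RHS]opprD [RHS]addrACA subrr addr0 opprD addrACA.
Qed.

Section RepresentativeFunctions.
Variables (F : fieldType) (g : lieAlgType F).
Local Notation U := (uenv g).

Definition two_sided_ideal (I : U -> Prop) : Prop :=
  [/\ I 0, forall u v, I u -> I v -> I (u + v),
      forall a u, I u -> I (a * u) & forall a u, I u -> I (u * a)].

(* U / I embeds in some F^n *)
Definition finite_codim (I : U -> Prop) : Prop :=
  exists (n : nat) (p : U -> 'rV[F]_n),
    linear p /\ forall u, I u <-> p u = 0.

Definition is_representative (f : U -> F^o) : Prop :=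
  linear f /\
  exists I, [/\ two_sided_ideal I, finite_codim I & forall u, I u -> f u = 0].

Definition representative : {pred U -> F^o} :=
  fun f => `[< is_representative f >].

Lemma representative_submod : submod_closed representative.
Proof.
split.
- apply/asboolP; split=> [c u v|]; first by rewrite /= scaler0 addr0.
  exists (fun=> True); split=> //; exists 0, (fun=> 0); split=> [c u v|u].
    by rewrite scaler0 addr0.
  by split.
- move=> c f h /asboolP[fl [I [[I0 ID Il Ir] [n [p [pl pI]]] If]]].
  move=> /asboolP[hl [J [[J0 JD Jl Jr] [m [q [ql qJ]]] Jh]]].
  apply/asboolP; split.
    move=> d u v; rewrite !fctE fl hl !scalerDr !scalerA (mulrC c d).
    by rewrite addrACA.
  exists (fun u => I u /\ J u); split.
  + split=> //.
    * by move=> u v [? ?] [? ?]; split; [apply: ID|apply: JD].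
    * by move=> a u [? ?]; split; [apply: Il|apply: Jl].
    * by move=> a u [? ?]; split; [apply: Ir|apply: Jr].
  + exists (n + m), (fun u => row_mx (p u) (q u)); split.
      by move=> d u v; rewrite pl ql scale_row_mx add_row_mx.
    move=> u; split=> [[/pI -> /qJ ->]|e]; first exact: row_mx0.
    by move: e; rewrite -row_mx0 => /eq_row_mx[/pI ? /qJ ?].
  + by move=> u [/If fu /Jh hu]; rewrite !fctE fu hu scaler0 addr0.
Qed.

HB.instance Definition _ :=
  GRing.isSubmodClosed.Build F (U -> F^o) representative representative_submod.

Record repfun := RepFun { repfun_val :> U -> F^o; _ : repfun_val \in representative }.

HB.instance Definition _ := [isSub for repfun_val].
HB.instance Definition _ := [Choice of repfun by <:].
HB.instance Definition _ := [SubChoice_isSubLmodule of repfun by <:].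

(* The element of R(g) with values phi.  It is used below only for functionals
   that do belong to R(g); the default value 0 is never reached. *)
Definition to_repfun (phi : U -> F^o) : repfun := insubd 0 phi.

(* (f h)(v) = f(v_(1)) h(v_(2)) *)
Definition rmul (f h : repfun) : repfun :=
  to_repfun (fun v => tlift (fun a b => f a * h b : F^o) (ucoprod v)).

(* The unique element f_(1) (x) f_(2) with f_(1)(v) f_(2)(w) = f(v w). *)
Definition rcoprod (f : repfun) : tensor repfun repfun :=
  xget 0 [set t | forall v w,
    tlift (fun f1 f2 : repfun => f1 v * f2 w : F^o) t = f (v * w)]%classic.

Definition rcounit (f : repfun) : F := f 1.

(* m (x) f |-> f(v) m *)
Definition tens_at (M : lmodType F) (t : tensor M repfun) (v : U) : M :=
  tlift (fun m (f : repfun) => f v *: m) t.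

Definition is_comodule (M : lmodType F) (nabla : M -> tensor M repfun) : Prop :=
  [/\ linear nabla,
      forall m, tassoc (tmap nabla id (nabla m)) = tmap id rcoprod (nabla m)
    & forall m, tlift (fun m0 f => rcounit f *: m0) (nabla m) = m].

Definition coaction_determined_by (M : lmodType F) (act : g -> M -> M)
    (nabla : M -> tensor M repfun) : Prop :=
  forall m v, uact act v m = tens_at (nabla m) v.

End RepresentativeFunctions.

(* mpl z X is the left action z |> X and mpr z X the right action z <| X *)
Record matched_pair (F : fieldType) (g1 g2 : lieAlgType F) := MatchedPair {
  mpl : g2 -> g1 -> g1;
  mpr : g2 -> g1 -> g2;
  mpl_module : is_lie_module mpl;
  mpr_bilinear : bilinear_map mpr;
  mpr_lie : forall z X Y, mpr z (lie X Y) = mpr (mpr z X) Y - mpr (mpr z Y) X;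
  mpl_compat : forall z X Y,
    mpl z (lie X Y) = lie (mpl z X) Y + lie X (mpl z Y)
                      + mpl (mpr z X) Y - mpl (mpr z Y) X;
  mpr_compat : forall z x X,
    mpr (lie z x) X = lie (mpr z X) x + lie z (mpr x X)
                      + mpr z (mpl x X) - mpr x (mpl z X) }.

Section DoubleCrossedSum.
Variables (F : fieldType) (g1 g2 : lieAlgType F) (mp : matched_pair g1 g2).

Definition dcsum of matched_pair g1 g2 : Type := (g1 * g2)%type.
HB.instance Definition _ := Vector.on (dcsum mp).

Definition dclie (x y : dcsum mp) : dcsum mp :=
  (lie x.1 y.1 + mpl mp x.2 y.1 - mpl mp y.2 x.1,
   lie x.2 y.2 + mpr mp x.2 y.1 - mpr mp y.2 x.1).

Let lieC (h : lieAlgType F) (x y : h) : lie x y = - lie y x.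
Proof.
apply/eqP; rewrite -addr_eq0; apply/eqP.
by have := liexx (x + y); rewrite lieDl !lieDr !liexx add0r addr0.
Qed.


Let vec_ext (V : vectType F) (x y : V) :
  (forall phi : V -> F, {morph phi : a b / a + b} -> {morph phi : a / - a} ->
     phi 0 = 0 -> phi x = phi y) -> x = y.
Proof.
move=> h; rewrite (coord_vbasis (memvf x)) (coord_vbasis (memvf y)).
apply: eq_bigr => i _; congr (_ *: _).
by apply: h => [a b|a|]; rewrite ?linearD ?linearN ?linear0.
Qed.

Let pair_eqP (x y : dcsum mp) : x.1 = y.1 -> x.2 = y.2 -> x = y.
Proof. by case: x y => [? ?] [? ?] /= -> ->. Qed.

Let lDl := fun X => linear_mapD ((mpl_module mp).1.1 X).
Let lZl := fun X => linear_mapZ ((mpl_module mp).1.1 X).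
Let lDr := fun z => linear_mapD ((mpl_module mp).1.2 z).
Let lBr := fun z => linear_mapB ((mpl_module mp).1.2 z).
Let lBl := fun z => linear_mapB ((mpl_module mp).1.1 z).
Let lZr := fun z => linear_mapZ ((mpl_module mp).1.2 z).
Let rDl := fun X => linear_mapD ((mpr_bilinear mp).1 X).
Let rBl := fun X => linear_mapB ((mpr_bilinear mp).1 X).
Let rZl := fun X => linear_mapZ ((mpr_bilinear mp).1 X).
Let rDr := fun z => linear_mapD ((mpr_bilinear mp).2 z).
Let rBr := fun z => linear_mapB ((mpr_bilinear mp).2 z).
Let rZr := fun z => linear_mapZ ((mpr_bilinear mp).2 z).

Let dclieDl x y z : dclie (x + y) z = dclie x z + dclie y z.
Proof.
apply: pair_eqP; rewrite /dclie /= !lieDl ?(lDl, rDl) ?(lDr, rDr);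
  by apply: vec_ext => phi phiD phiN phi0; rewrite !(phiD, phiN, phi0); ring.
Qed.

Let dclieZl c x y : dclie (c *: x) y = c *: dclie x y.
Proof.
apply: pair_eqP; rewrite /dclie /= !lieZl ?(lZl, rZl) ?(lZr, rZr);
  by rewrite !scalerBr !scalerDr.
Qed.

Let dclieC x y : dclie x y = - dclie y x.
Proof.
apply: pair_eqP; rewrite /dclie /= [in LHS]lieC;
  by apply: vec_ext => phi phiD phiN phi0; rewrite !(phiD, phiN, phi0); ring.
Qed.

Let dcliexx x : dclie x x = 0.
Proof. by apply: pair_eqP; rewrite /dclie /= liexx add0r subrr. Qed.

Let dclieDr x y z : dclie x (y + z) = dclie x y + dclie x z.
Proof. by rewrite dclieC dclieDl opprD -!dclieC. Qed.

Let dclieZr c x y : dclie x (c *: y) = c *: dclie x y.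
Proof. by rewrite dclieC dclieZl -scalerN -dclieC. Qed.

Let lieBr (h : lieAlgType F) (x y z : h) : lie x (y - z) = lie x y - lie x z.
Proof. by rewrite lieDr -[- z]scaleN1r lieZr scaleN1r. Qed.

Let dclieJ x y z :
  dclie x (dclie y z) + dclie y (dclie z x) + dclie z (dclie x y) = 0.
Proof.
case: x y z => [X a] [Y b] [Z c]; apply: pair_eqP => /=.
- have J := lieJ X Y Z; rewrite -addrA in J; move/eqP: J.
  rewrite addr_eq0 => /eqP J; rewrite !lieBr !lieDr !lBr !lBl !lDr !lDl.
  rewrite !(mpl_compat mp) !(mpl_module mp).2.
  rewrite J.
  rewrite (lieC (mpl mp a Y) Z) (lieC (mpl mp b Z) X) (lieC (mpl mp c X) Y).
  by apply: vec_ext => phi phiD phiN phi0; rewrite !(phiD, phiN, phi0); ring.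
- have J := lieJ a b c; rewrite -addrA in J; move/eqP: J.
  rewrite addr_eq0 => /eqP J; rewrite !lieBr !lieDr !rBr !rBl !rDr !rDl.
  rewrite !(mpr_compat mp) !(mpr_lie mp).
  rewrite J.
  rewrite (lieC (mpr mp b X) c) (lieC (mpr mp c Y) a) (lieC (mpr mp a Z) b).
  by apply: vec_ext => phi phiD phiN phi0; rewrite !(phiD, phiN, phi0); ring.
Qed.

HB.instance Definition _ := hasLieBracket.Build F (dcsum mp)
  dclieDl dclieZl dcliexx dclieDr dclieZr dclieJ.

Definition dcinl (X : g1) : dcsum mp := (X, 0).
Definition dcinr (z : g2) : dcsum mp := (0, z).

Definition uinl : uenv g1 -> uenv (dcsum mp) := ulift (fun X => uinj (dcinl X)).
Definition uinr : uenv g2 -> uenv (dcsum mp) := ulift (fun z => uinj (dcinr z)).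

Definition umult : tensor (uenv g1) (uenv g2) -> uenv (dcsum mp) :=
  tlift (fun u v => uinl u * uinr v).

(* Psi(v (x) u), the preimage of v u under the bijection umult *)
Definition upsi (v : uenv g2) (u : uenv g1) : tensor (uenv g1) (uenv g2) :=
  xget 0 [set t | umult t = uinr v * uinl u]%classic.

(* v |> u = (id (x) epsilon) Psi(v (x) u),
   v <| u = (epsilon (x) id) Psi(v (x) u) *)
Definition umpl (v : uenv g2) (u : uenv g1) : uenv g1 :=
  tlift (fun u' v' => (ucounit v' : F) *: u') (upsi v u).

Definition umpr (v : uenv g2) (u : uenv g1) : uenv g2 :=
  tlift (fun u' v' => (ucounit u' : F) *: v') (upsi v u).

(* (X |> f)(v) = f(v <| X) *)
Definition ract (X : g1) (f : repfun g2) : repfun g2 :=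
  to_repfun (fun v => f (umpr v (uinj X))).

(* X_<0> (x) X_<1>, determined by v |> X = X_<1>(v) X_<0> in U(g1) *)
Definition gcoact (X : g1) : tensor g1 (repfun g2) :=
  xget 0 [set t | forall v, umpl v (uinj X) = uinj (tens_at t v)]%classic.

Definition is_induced_module (M : lmodType F) (act : g1 -> M -> M)
    (nabla : M -> tensor M (repfun g2)) : Prop :=
  [/\ is_lie_module act, is_comodule nabla &
      forall (X : g1) (m : M),
        nabla (act X m) =
          tlift (fun (X0 : g1) (X1 : repfun g2) =>
            tlift (fun m0 m1 => tens (act X0 m0) (rmul X1 m1)) (nabla m))
            (gcoact X)
          + tlift (fun m0 m1 => tens m0 (ract X m1)) (nabla m)].

Definition restrict1 (M : lmodType F) (act : dcsum mp -> M -> M) : g1 -> M -> M :=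
  fun X => act (dcinl X).

Definition restrict2 (M : lmodType F) (act : dcsum mp -> M -> M) : g2 -> M -> M :=
  fun z => act (dcinr z).

End DoubleCrossedSum.

(* Main.v *)
Require Import Defs.
From mathcomp Require Import all_boot all_order all_algebra.
From mathcomp Require Import boolp classical_sets functions.
From mathcomp Require Import reals complex.

(* The coaction of a locally finite g2-module is unique because elements of
   M (x) R(g2) are separated by evaluation at U(g2), and it exists because a
   linear functional f on U(g2) lies in R(g2) as soon as f(v w) is a finite sum
   of products of a function of v and a function of w.  The compatibility of an
   induced module is then, after evaluation at v in U(g2), the identity
     v (X m) = (v_(1) |> X) (v_(2) m) + (v <| X) m,
   which comes from v X = (v_(1) |> X) v_(2) + (v <| X) in U(g1 |><| g2).  To read
   v |> X and v <| X off this formula one needs that multiplication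
   U(g1) (x) U(g2) -> U(g1 |><| g2) is injective; this is obtained without the
   Poincare-Birkhoff-Witt theorem, by letting g1 |><| g2 act on
   U(g1) (x) U(g2).  Conversely the identity for v in g2 says exactly that the
   actions of g1 and g2 on an induced module generate one of g1 |><| g2. *)

Set Implicit Arguments.
Unset Strict Implicit.
Unset Printing Implicit Defensive.

Import GRing.Theory.
Local Open Scope ring_scope.

(** The proof works with neither bases of tensor products nor normal forms in enveloping algebras,
    so maps are built from universal properties and equalities are tested by functionals. The
    obstacle is the action of [g2] on U(g1) (x) U(g2). It should be the recursion z (X u) = X (z u)
    + (z |> X) u + (z <| X) u on the U(g1) factor, but each step changes z, and compatibility with
    the relations of U(g1) is not visible. Carrying all values z w along with w turns the recursion
    into an action of [g1] on pairs; once this is checked to be a Lie action, [uact] performs the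
    recursion and is automatically well defined. Finite rank of (v, w) |-> f(v w) is preferred to
    ideals because it can be read off from any formula expanding a product v w: this is how
    products, translates and X |> f are seen to stay in R(g2), and how the coproduct is found. *)

Section LinearMaps.
Variable F : fieldType.

Lemma linear_map_sum (V W : lmodType F) (f : V -> W) (I : Type) (r : seq I)
    (P : pred I) (E : I -> V) :
  linear f -> f (\sum_(i <- r | P i) E i) = \sum_(i <- r | P i) f (E i).
Proof.
move=> fl; apply: (big_morph f); last exact: linear_map0 fl.
by move=> x y; rewrite (linear_mapD fl).
Qed.

Lemma linear_map_id (V : lmodType F) : linear (@id V).
Proof. by []. Qed.

Lemma linear_map_comp (V W Z : lmodType F) (f : W -> Z) (h : V -> W) :
  linear f -> linear h -> linear (fun x => f (h x)).
Proof. by move=> fl hl c x y; rewrite hl fl. Qed.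

Lemma linear_map_add (V W : lmodType F) (f h : V -> W) :
  linear f -> linear h -> linear (fun x => f x + h x).
Proof. by move=> fl hl c x y; rewrite fl hl scalerDr addrACA. Qed.

Lemma linear_map_scale (V W : lmodType F) (c : F) (f : V -> W) :
  linear f -> linear (fun x => c *: f x).
Proof. by move=> fl d x y; rewrite fl scalerDr !scalerA mulrC. Qed.

Lemma linear_map_scalel (V W : lmodType F) (f : V -> F^o) (w : W) :
  linear f -> linear (fun x => (f x : F) *: w).
Proof. by move=> fl c x y; rewrite fl scalerDl -scalerA. Qed.

Lemma linear_map_sumf (V W : lmodType F) (I : Type) (r : seq I)
    (E : I -> V -> W) :
  (forall i, linear (E i)) -> linear (fun x => \sum_(i <- r) E i x).
Proof.
move=> El c x y; rewrite scaler_sumr -big_split /=.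
by apply: eq_bigr => i _; rewrite El.
Qed.

Lemma linear_map_mull (A : algType F) (a : A) : linear (fun x => a * x).
Proof. by move=> c x y; rewrite mulrDr scalerAr. Qed.

Lemma linear_map_mulr (A : algType F) (a : A) : linear (fun x => x * a).
Proof. by move=> c x y; rewrite mulrDl scalerAl. Qed.

Lemma linear_map_vbasis (g : vectType F) (W : lmodType F) (f : g -> W) x :
  linear f -> f x = \sum_i coord (vbasis fullv) i x *: f (vbasis fullv)`_i.
Proof.
move=> fl; rewrite {1}(coord_vbasis (memvf x)) (linear_map_sum _ _ _ fl).
by apply: eq_bigr => i _; rewrite (linear_mapZ fl).
Qed.

End LinearMaps.

(** * Tensor products: extensionality and separation by functionals *)

Section Tensors.
Variables (F : fieldType) (V W : lmodType F).

Lemma tens_linearl (w : W) : linear (fun v : V => tens v w).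
Proof. by have [tl _] := tens_bilinear V W; apply: tl. Qed.

Lemma tens_linearr (v : V) : linear (fun w : W => tens v w).
Proof. by have [_ tr] := tens_bilinear V W; apply: tr. Qed.

Lemma tens_linear_ext (Z : lmodType F) (f h : tensor V W -> Z) :
  linear f -> linear h -> (forall v w, f (tens v w) = h (tens v w)) -> f =1 h.
Proof.
move=> fl hl fh; elim/tens_ind => [|v w|x y ihx ihy|c x ihx].
- by rewrite (linear_map0 fl) (linear_map0 hl).
- exact: fh.
- by rewrite (linear_mapD fl) (linear_mapD hl) ihx ihy.
- by rewrite (linear_mapZ fl) (linear_mapZ hl) ihx.
Qed.

Lemma tlift_fun_linear (X Z : lmodType F) (b : X -> V -> W -> Z) t :
  (forall x, bilinear_map (b x)) -> (forall v w, linear (fun x => b x v w)) ->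
  linear (fun x => tlift (b x) t).
Proof.
move=> bb bl c x y; elim/tens_ind: t => [|v w|s t ihs iht|d s ihs].
- by rewrite !(linear_map0 (tlift_linear (bb _))) scaler0 addr0.
- by rewrite !tlift_tens; try exact: bb; exact: bl.
- rewrite !(linear_mapD (tlift_linear (bb _))) ihs iht.
  by rewrite scalerDr addrACA.
- rewrite !(linear_mapZ (tlift_linear (bb _))) ihs.
  by rewrite scalerDr !scalerA mulrC.
Qed.

Lemma eq_tlift (Z : lmodType F) (b b' : V -> W -> Z) t :
  (forall v w, b v w = b' v w) -> tlift b t = tlift b' t.
Proof.
by move=> e; congr (tlift _ t); apply: funext => v; apply: funext => w.
Qed.

Lemma tensor_sum (t : tensor V W) :
  exists s : seq (V * W), t = \sum_(p <- s) tens p.1 p.2.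
Proof.
elim/tens_ind: t => [|v w|x y [s ->] [s' ->]|c x [s ->]].
- by exists [::]; rewrite big_nil.
- by exists [:: (v, w)]; rewrite big_seq1.
- by exists (s ++ s'); rewrite big_cat.
- exists [seq (c *: p.1, p.2) | p <- s]; rewrite big_map scaler_sumr.
  by apply: eq_bigr => p _; rewrite (linear_mapZ (tens_linearl _)).
Qed.

Lemma slice_bilinear (phi : W -> F^o) :
  linear phi -> bilinear_map (fun (v : V) w => (phi w : F) *: v).
Proof.
move=> pl; split=> [w c x y|v]; last exact: linear_map_scalel.
by rewrite scalerDr !scalerA mulrC.
Qed.

(* If w_1 != 0, some phi has phi w_1 != 0, and phi applied to
   sum v_i (x) w_i = 0 expresses v_1 through the other v_i: the sum can be
   rewritten with one term less. *)
Lemma tensor_separated (I : Type) (phi : I -> W -> F^o) :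
  (forall i, linear (phi i)) ->
  (forall w, (forall i, phi i w = 0) -> w = 0) ->
  forall t : tensor V W,
    (forall i, tlift (fun v w => (phi i w : F) *: v) t = 0) -> t = 0.
Proof.
move=> pl sep t; have [s ->] := tensor_sum t; move: {2}(size s) (erefl (size s)).
move=> n; elim: n s => [|n ih] [|[v w] s] //=; first by rewrite big_nil.
move=> /eqP; rewrite eqSS => /eqP sz h.
have sl i := tlift_linear (slice_bilinear (pl i)).
rewrite big_cons /=.
have [w0|wn0] := pselect (w = 0).
  move: h; rewrite w0 => h; rewrite (linear_map0 (tens_linearr v)) add0r.
  apply: ih => // i.
  have := h i; rewrite big_cons (linear_mapD (sl i)).
  by rewrite (linear_map0 (tens_linearr v)) (linear_map0 (sl i)) add0r.
have [i piw] : exists i, phi i w != 0.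
  apply: contrapT => /forallNP hn; apply: wn0; apply: sep => i.
  by apply/eqP; apply/negPn/negP; apply: hn.
pose c (p : V * W) : F := - ((phi i w)^-1 * phi i p.2).
have ve : v = \sum_(p <- s) c p *: p.1.
  have := h i; rewrite big_cons (linear_mapD (sl i)) (linear_map_sum _ _ _ (sl i)).
  rewrite tlift_tens /=; last exact: slice_bilinear.
  move/eqP; rewrite addr_eq0 => /eqP e.
  rewrite -[LHS]scale1r -(mulVf piw) -scalerA e scalerN scaler_sumr -sumrN.
  apply: eq_bigr => p _; rewrite tlift_tens; last exact: slice_bilinear.
  by rewrite scalerA /c scaleNr.
have -> : tens v w + \sum_(p <- s) tens p.1 p.2 =
    \sum_(p <- [seq (p.1, c p *: w + p.2) | p <- s]) tens p.1 p.2.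
  rewrite big_map {1}ve (linear_map_sum _ _ _ (tens_linearl w)) -big_split /=.
  apply: eq_bigr => p _; rewrite (linear_mapZ (tens_linearl w)).
  by rewrite (linear_mapD (tens_linearr _)) (linear_mapZ (tens_linearr _)).
apply: ih => [|j]; first by rewrite size_map.
have := h j; rewrite big_cons /= => e; rewrite -{}[RHS]e; congr tlift.
rewrite big_map {1}ve (linear_map_sum _ _ _ (tens_linearl w)) -big_split /=.
apply: eq_bigr => p _; rewrite (linear_mapZ (tens_linearl w)).
by rewrite (linear_mapD (tens_linearr _)) (linear_mapZ (tens_linearr _)).
Qed.

End Tensors.

(** * Functions of two variables of finite rank *)

Section FiniteRank.
Variable F : fieldType.

(** Points are chosen so that the span of their values has maximal dimension; adding one more point
    cannot enlarge that span. *)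
Lemma finite_spanning_values (T : Type) n (G : T -> 'rV[F]_n) :
  exists (k : nat) (t : 'I_k -> T),
    forall x, exists c : 'I_k -> F, G x = \sum_i c i *: G (t i).
Proof.
pose P d := `[< exists s : seq T, \dim <<[seq G x | x <- s]>>%VS = d >].
have P0 : exists d, P d.
  by exists (\dim <<[seq G x | x <- [::]]>>%VS); apply/asboolP; exists [::].
have Pmax d : P d -> (d <= \dim {:'rV[F]_n})%N.
  by move=> /asboolP[s <-]; apply: dimvS; apply: subvf.
have [d /asboolP[s sd] dmax] := ex_maxnP P0 Pmax.
exists (size s), (tnth (in_tuple s)) => x.
have Gx : G x \in <<[seq G y | y <- s]>>%VS.
  have sub : (<<[seq G y | y <- s]>> <= <<[seq G y | y <- x :: s]>>)%VS.
    by rewrite /= span_cons addvSr.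
  have : (\dim <<[seq G y | y <- x :: s]>> <= \dim <<[seq G y | y <- s]>>)%N.
    by rewrite sd; apply: dmax; apply/asboolP; exists (x :: s).
  move=> le; have /eqP -> : <<[seq G y | y <- s]>>%VS == <<[seq G y | y <- x :: s]>>%VS.
    by rewrite eqEdim sub le.
  by apply: memv_span; rewrite /= inE eqxx.
have := coord_span (X := map_tuple G (in_tuple s)) Gx.
move=> e; exists (fun i => coord (map_tuple G (in_tuple s)) i (G x)).
rewrite {1}e; apply: eq_bigr => i _; congr (_ *: _).
by rewrite -tnth_nth tnth_map.
Qed.

(** No linearity is asked of the factors, so they may come from arbitrary choices of
    coefficients. *)
Definition finite_rank (S T : Type) (B : S -> T -> F) : Prop :=
  exists (J : finType) (G : J -> S -> F) (H : J -> T -> F),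
    forall x y, B x y = \sum_j G j x * H j y.

(** Choose points whose rows and columns span all rows and columns of [B], and let A be the matrix
    of the values [B (s j) (t i)]. Then B(x, y) = c A d for some coefficients c and d, while c A and
    A d are the values of [B] at (x, t_i) and (s_j, y). Inserting A = A N A with N the
    pseudo-inverse removes c and d: the factors become [B] itself with one argument frozen. *)
Lemma finite_rank_skeleton (S T : Type) (B : S -> T -> F) : finite_rank B ->
  exists (k l : nat) (s : 'I_k -> S) (t : 'I_l -> T) (N : 'M[F]_(l, k)),
    forall x y, B x y = \sum_i \sum_j B x (t i) * N i j * B (s j) y.
Proof.
move=> [J [G [H BE]]].
have [k [s sP]] := finite_spanning_values (fun x => \row_(i < #|J|) G (enum_val i) x).
have [l [t tP]] := finite_spanning_values (fun y => \row_(i < #|J|) H (enum_val i) y).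
pose Mx := \matrix_(j < k, i < l) B (s j) (t i).
exists k, l, s, t, (pinvmx Mx) => x y.
have [c cP] := sP x; have [d dP] := tP y.
have GE j : G j x = \sum_i c i * G j (s i).
  have := congr1 (fun r : 'rV_#|J| => r 0 (enum_rank j)) cP.
  rewrite mxE enum_rankK summxE => ->.
  by apply: eq_bigr => i _; rewrite !mxE enum_rankK.
have HE j : H j y = \sum_i d i * H j (t i).
  have := congr1 (fun r : 'rV_#|J| => r 0 (enum_rank j)) dP.
  rewrite mxE enum_rankK summxE => ->.
  by apply: eq_bigr => i _; rewrite !mxE enum_rankK.
have Bx z : B x z = \sum_i c i * B (s i) z.
  rewrite BE (eq_bigr (fun j => \sum_i c i * (G j (s i) * H j z))); last first.
    by move=> j _; rewrite GE mulr_suml; apply: eq_bigr => i _; rewrite mulrA.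
  by rewrite exchange_big; apply: eq_bigr => i _; rewrite BE mulr_sumr.
have By z : B z y = \sum_i B z (t i) * d i.
  rewrite BE (eq_bigr (fun j => \sum_i G j z * H j (t i) * d i)); last first.
    move=> j _; rewrite HE mulr_sumr; apply: eq_bigr => i _.
    by rewrite [d i * _]mulrC mulrA.
  by rewrite exchange_big; apply: eq_bigr => i _; rewrite BE mulr_suml.
pose cr := \row_j c j; pose dc := \col_i d i.
have cM i : (cr *m Mx) 0 i = B x (t i).
  by rewrite mxE Bx; apply: eq_bigr => j _; rewrite !mxE.
have Md j : (Mx *m dc) j 0 = B (s j) y.
  by rewrite mxE By; apply: eq_bigr => i _; rewrite !mxE.
transitivity ((cr *m Mx *m dc) 0 0).
  by rewrite -mulmxA mxE Bx; apply: eq_bigr => j _; rewrite Md mxE.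
rewrite -[in LHS](mulmxKpV (submx_refl Mx)) mulmxA.
rewrite -(mulmxA _ Mx dc) (mulmxA cr) mxE.
transitivity (\sum_j (\sum_i B x (t i) * pinvmx Mx i j) * B (s j) y).
  apply: eq_bigr => j _; rewrite Md mxE; congr (_ * _).
  by apply: eq_bigr => i _; rewrite cM.
rewrite exchange_big; apply: eq_bigr => j _.
by rewrite mulr_suml.
Qed.

End FiniteRank.

(** * Enveloping algebras and their modules *)

Section Enveloping.
Variables (F : fieldType) (g : lieAlgType F).
Local Notation U := (uenv g).

Lemma uenv_left_ind (P : U -> Prop) :
  P 1 -> (forall c u, P u -> P (c *: u)) ->
  (forall u v, P u -> P v -> P (u + v)) ->
  (forall x u, P u -> P (uinj x * u)) -> forall u, P u.
Proof.
(* The factor 1 is generalized to any w satisfying [P], so that the product case u v w applies the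
   two hypotheses in turn. *)
move=> P1 PZ PD PM u; rewrite -[u]mulr1.
elim/uenv_ind: u 1 P1 => [c|x|u v ihu ihv|u v ihu ihv] w Pw.
- by rewrite -scalerAl mul1r; apply: PZ.
- exact: PM.
- by rewrite mulrDl; apply: PD; [apply: ihu|apply: ihv].
- by rewrite -mulrA; apply: ihu; apply: ihv.
Qed.

Lemma uinj_linear : linear (uinj : g -> U).
Proof. by have [] := uinj_lie_hom g. Qed.

Lemma uinj_lie (x y : g) : uinj (lie x y) = uinj x * uinj y - uinj y * uinj x.
Proof. by have [_ ->] := uinj_lie_hom g. Qed.

Lemma ucounit_linear : linear (ucounit : U -> F^o).
Proof. exact: ulift_linear (zero_lie_hom _). Qed.

Lemma ucounit1 : ucounit (1 : U) = 1.
Proof. exact: ulift1 (zero_lie_hom _). Qed.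

Lemma ucounit_uinj (x : g) : ucounit (uinj x) = 0.
Proof. exact: ulift_uinj (zero_lie_hom _) _. Qed.

Lemma ucounitM (u v : U) : ucounit (u * v) = ucounit u * ucounit v.
Proof. exact: uliftM (zero_lie_hom _) _ _. Qed.

Lemma ucoprod_linear : linear (@ucoprod F g).
Proof. exact: ulift_linear (ucoprod_lie_hom _). Qed.

Lemma ucoprod1 : ucoprod (1 : U) = tens 1 1.
Proof. exact: ulift1 (ucoprod_lie_hom _). Qed.

Lemma ucoprod_uinj (x : g) : ucoprod (uinj x) = tens (uinj x) 1 + tens 1 (uinj x).
Proof. exact: ulift_uinj (ucoprod_lie_hom _) _. Qed.

Lemma ucoprodM (u v : U) : ucoprod (u * v) = ucoprod u * ucoprod v.
Proof. exact: uliftM (ucoprod_lie_hom _) _ _. Qed.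

Lemma mul_tens (h : lieAlgType F) (a a' : U) (b b' : uenv h) :
  tens a b * tens a' b' = tens (a * a') (b * b').
Proof. exact: tmul_tens. Qed.

Lemma ucoprod_counit (v : U) :
  tlift (fun a b => (ucounit b : F) *: a) (ucoprod v) = v.
Proof.
have bl := slice_bilinear U ucounit_linear; have tl := tlift_linear bl.
elim/uenv_left_ind: v => [|c u ih|u v ihu ihv|x u ih].
- by rewrite ucoprod1 tlift_tens // ucounit1 scale1r.
- by rewrite (linear_mapZ ucoprod_linear) (linear_mapZ tl) ih.
- by rewrite (linear_mapD ucoprod_linear) (linear_mapD tl) ihu ihv.
- rewrite ucoprodM ucoprod_uinj -[in RHS]ih.
  move: (ucoprod u); apply: tens_linear_ext.
  + exact: linear_map_comp tl (@linear_map_mull _ _ _).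
  + exact: linear_map_comp (@linear_map_mull _ _ _) tl.
  + move=> a b; rewrite mulrDl !mul_tens !mul1r (linear_mapD tl) !tlift_tens //.
    by rewrite ucounitM ucounit_uinj mul0r scale0r addr0 scalerAr.
Qed.

End Enveloping.

Section LieModule.
Variables (F : fieldType) (g : lieAlgType F) (M : lmodType F).
Variable act : g -> M -> M.
Hypothesis act_mod : is_lie_module act.

Lemma lie_module_linearl m : linear (act^~ m).
Proof. by case: act_mod => [[al _] _]; apply: al. Qed.

Lemma lie_module_linearr x : linear (act x).
Proof. by case: act_mod => [[_ ar] _]; apply: ar. Qed.

Lemma uact_linearl m : linear (fun u => uact act u m).
Proof. by case: (uact_bilinear act_mod) => al _; apply: al. Qed.

Lemma uact_linearr u : linear (uact act u).
Proof. by case: (uact_bilinear act_mod) => _ ar; apply: ar. Qed.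

Lemma uact_uinjM x u m : uact act (uinj x * u) m = act x (uact act u m).
Proof. by rewrite uactM // uact_uinj. Qed.

End LieModule.

(** * Structure maps of R(g) through finite rank *)

Section RepresentativeFunctions.
Variables (F : fieldType) (g : lieAlgType F).
Local Notation U := (uenv g).
Local Notation R := (repfun g).

(** If the classes of the t_i span U / I, then w is congruent to a combination of the t_i modulo I,
    and f(v w) is the same combination of the f(v t_i), since I is a left ideal killed by f. *)
Lemma is_representative_finite_rank (f : U -> F^o) :
  is_representative f -> finite_rank (fun v w => f (v * w) : F).
Proof.
move=> [fl [I [[I0 ID Il Ir] [n [p [pl pI]]] If]]].
have [k [t tP]] := finite_spanning_values p.
have [c cP] := choice tP.
exists 'I_k, (fun j v => f (v * t j)), (fun j w => c w j) => v w.
have : f (v * (w - \sum_i c w i *: t i)) = 0.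
  apply/If/Il/pI; rewrite (linear_mapB pl) (linear_map_sum _ _ _ pl) cP.
  apply/eqP; rewrite subr_eq0; apply/eqP; apply: eq_bigr => i _.
  by rewrite (linear_mapZ pl).
rewrite mulrBr (linear_mapB fl) => /eqP; rewrite subr_eq0 => /eqP ->.
rewrite mulr_sumr (linear_map_sum _ _ _ fl); apply: eq_bigr => i _.
by rewrite -scalerAr (linear_mapZ fl) mulrC.
Qed.

(* The largest two-sided ideal {u | f (a u b) = 0 for all a, b} in the kernel
   of f is the kernel of u |-> (f (s_j u t_i)), where f (s_j _) and f (_ t_i)
   span the left and right translates of f. *)
Lemma finite_rank_is_representative (f : U -> F^o) :
  linear f -> finite_rank (fun v w => f (v * w) : F) -> is_representative f.
Proof.
move=> fl fr; split=> //.
have [k [l [s [t [N fE]]]]] := finite_rank_skeleton fr.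
exists (fun u => forall a b, f (a * u * b) = 0); split.
- split.
  + by move=> a b; rewrite mulr0 mul0r (linear_map0 fl).
  + by move=> u v hu hv a b; rewrite mulrDr mulrDl (linear_mapD fl) hu hv addr0.
  + by move=> a u hu b d; rewrite mulrA.
  + by move=> a u hu b d; rewrite mulrA -mulrA.
- exists (k * l)%N, (fun u => mxvec (\matrix_(j, i) f (s j * u * t i))); split.
    move=> c u v; rewrite -linearP; congr mxvec; apply/matrixP => i j.
    by rewrite !mxE mulrDr mulrDl -scalerAr -scalerAl fl.
  move=> u; split=> [h|e a b].
    rewrite -[RHS](linear0 mxvec); congr mxvec; apply/matrixP => i j.
    by rewrite !mxE.
  have /matrixP h : \matrix_(j, i) f (s j * u * t i) = 0.
    by rewrite -[LHS]mxvecK e linear0.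
  have hu a' i : f (a' * u * t i) = 0.
    rewrite -mulrA fE big1 // => i' _; rewrite big1 // => j _.
    have := h j i; rewrite !mxE -mulrA => ->.
    by rewrite mulr0.
  by rewrite fE big1 // => i _; rewrite big1 // => j _; rewrite hu !mul0r.
- by move=> u /(_ 1 1); rewrite mul1r mulr1.
Qed.

Lemma repfunP (f : R) : is_representative f.
Proof. by case: f => f /= /asboolP. Qed.

Lemma repfun_linear (f : R) : linear f.
Proof. by case: (repfunP f). Qed.

Lemma repfun_eval_linear v : linear (fun f : R => f v).
Proof. by []. Qed.

Lemma repfun_ext (f h : R) : f =1 h -> f = h.
Proof. by move=> e; apply: val_inj; apply: funext. Qed.

Lemma to_repfunE (phi : U -> F^o) v :
  is_representative phi -> to_repfun phi v = phi v.
Proof. by move=> h; rewrite /to_repfun (insubdK _ _) //; apply/asboolP. Qed.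

Lemma repfun_sumE (I : Type) (r : seq I) (E : I -> R) v :
  (\sum_(i <- r) E i) v = \sum_(i <- r) E i v.
Proof. exact: linear_map_sum (repfun_eval_linear v). Qed.

Lemma is_representative_translatel (f : R) a :
  is_representative (fun v => f (a * v)).
Proof.
apply: finite_rank_is_representative.
  exact: linear_map_comp (repfun_linear f) (@linear_map_mull _ _ a).
have [J [G [H fE]]] := is_representative_finite_rank (repfunP f).
by exists J, (fun j v => G j (a * v)), H => v w; rewrite mulrA fE.
Qed.

Lemma is_representative_translater (f : R) a :
  is_representative (fun v => f (v * a)).
Proof.
apply: finite_rank_is_representative.
  exact: linear_map_comp (repfun_linear f) (@linear_map_mulr _ _ a).
have [J [G [H fE]]] := is_representative_finite_rank (repfunP f).
by exists J, G, (fun j w => H j (w * a)) => v w; rewrite -mulrA fE.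
Qed.

(** The factors given by the skeleton are combinations of left and right translates of f, hence lie
    in R(g) again; this yields the coproduct of f. *)
Lemma repfun_decomposition (f : R) :
  exists (n : nat) (G H : 'I_n -> R),
    forall v w, f (v * w) = \sum_i (G i v : F) * H i w.
Proof.
have [k [l [s [t [N fE]]]]] :=
  finite_rank_skeleton (is_representative_finite_rank (repfunP f)).
exists l, (fun i => to_repfun (fun v => f (v * t i))),
  (fun i => \sum_j N i j *: to_repfun (fun w => f (s j * w))) => v w.
rewrite fE; apply: eq_bigr => i _.
rewrite to_repfunE; last exact: is_representative_translater.
rewrite repfun_sumE mulr_sumr; apply: eq_bigr => j _.
rewrite -mulrA; congr (_ * _).
rewrite (linear_mapZ (repfun_eval_linear w)) to_repfunE //.
exact: is_representative_translatel.
Qed.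

Lemma eval2_bilinear (v w : U) :
  bilinear_map (fun f1 f2 : R => (f1 v : F) * f2 w : F^o).
Proof.
split=> [f c x y|f c x y].
- by rewrite -[(c *: x + y) v]/(c * (x v : F) + y v) mulrDl -mulrA.
- by rewrite -[(c *: x + y) w]/(c * (x w : F) + y w) mulrDr mulrCA.
Qed.

Lemma rcoprodE (f : R) v w :
  tlift (fun f1 f2 : R => (f1 v : F) * f2 w : F^o) (rcoprod f) = f (v * w).
Proof.
suff [t tP] : exists t : tensor R R, forall v w,
    tlift (fun f1 f2 : R => (f1 v : F) * f2 w : F^o) t = f (v * w).
  by have := @xgetPex _ 0 [set t : tensor R R | forall v w,
    tlift (fun f1 f2 : R => (f1 v : F) * f2 w : F^o) t = f (v * w)]%classic
    (ex_intro _ t tP); apply.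
have [n [G [H fE]]] := repfun_decomposition f.
exists (\sum_i tens (G i) (H i)) => {}v {}w; rewrite fE.
rewrite (linear_map_sum _ _ _ (tlift_linear (eval2_bilinear v w))).
by apply: eq_bigr => i _; rewrite (tlift_tens (eval2_bilinear v w)).
Qed.

Lemma eval_pair_bilinear (f h : R) :
  bilinear_map (fun a b : U => (f a : F) * h b : F^o).
Proof.
split=> [w c u v|w c u v].
- by rewrite (repfun_linear f) -[_ *: _ + _]/(c * (f u : F) + f v) mulrDl -mulrA.
- by rewrite (repfun_linear h) -[_ *: _ + _]/(c * (h u : F) + h v) mulrDr mulrCA.
Qed.

(** The point is that the default of [to_repfun] is not reached. As the coproduct of U(g) is
    multiplicative, (f h)(x y) = f(x_(1) y_(1)) h(x_(2) y_(2)), and splitting f and h gives the sum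
    of (G_i G'_j)(x) (H_i H'_j)(y). *)
Lemma rmulE (f h : R) v :
  rmul f h v = tlift (fun a b => (f a : F) * h b : F^o) (ucoprod v).
Proof.
have bl f' h' := tlift_linear (eval_pair_bilinear f' h').
rewrite /rmul to_repfunE //; apply: finite_rank_is_representative.
  exact: linear_map_comp (bl _ _) (@ucoprod_linear _ _).
have [n [G [H fE]]] := repfun_decomposition f.
have [n' [G' [H' hE]]] := repfun_decomposition h.
exists ('I_n * 'I_n')%type,
  (fun j v => tlift (fun a b => (G j.1 a : F) * G' j.2 b : F^o) (ucoprod v)),
  (fun j v => tlift (fun a b => (H j.1 a : F) * H' j.2 b : F^o) (ucoprod v)).
move=> x y; rewrite ucoprodM; move: (ucoprod x) (ucoprod y) => {x y} x y.
move: x; apply: (@tens_linear_ext F _ _ F^o).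
- exact: linear_map_comp (bl _ _) (@linear_map_mulr _ _ y).
- by apply: linear_map_sumf => j; apply: (@linear_map_scalel _ _ F^o); apply: bl.
move=> a b.
move: y; apply: (@tens_linear_ext F _ _ F^o).
- exact: linear_map_comp (bl _ _) (@linear_map_mull _ _ _).
- by apply: linear_map_sumf => j; apply: (@linear_map_scale _ _ F^o); apply: bl.
move=> a' b'; rewrite mul_tens (tlift_tens (eval_pair_bilinear _ _)) fE hE.
rewrite mulr_suml -(pair_bigA _ (fun i j => (tlift (fun a b => (G i a : F) * G' j b : F^o)
  (tens a b) : F) * tlift (fun a b => (H i a : F) * H' j b : F^o) (tens a' b'))) /=.
apply: eq_bigr => i _; rewrite mulr_sumr; apply: eq_bigr => j _.
by rewrite !(tlift_tens (eval_pair_bilinear _ _)) mulrACA.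
Qed.

End RepresentativeFunctions.

(** * Evaluation at U(g) separates tensors with values in R(g) *)

Section Evaluation.
Variables (F : fieldType) (g : lieAlgType F) (M : lmodType F).
Local Notation U := (uenv g).
Local Notation R := (repfun g).

Lemma tens_at_bilinear (v : U) :
  bilinear_map (fun (m : M) (f : R) => (f v : F) *: m).
Proof. exact: slice_bilinear (repfun_eval_linear v). Qed.

Lemma tens_at_linear v : linear (fun t : tensor M R => tens_at t v).
Proof. exact: tlift_linear (tens_at_bilinear v). Qed.

Lemma tens_at_tens (m : M) (f : R) v : tens_at (tens m f) v = (f v : F) *: m.
Proof. exact: tlift_tens (tens_at_bilinear v) _ _. Qed.

Lemma tens_at_linearr (t : tensor M R) : linear (tens_at t).
Proof.
apply: tlift_fun_linear => [v|m f]; first exact: tens_at_bilinear.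
by apply: linear_map_scalel; apply: repfun_linear.
Qed.

Lemma tens_at_inj (t t' : tensor M R) :
  (forall v, tens_at t v = tens_at t' v) -> t = t'.
Proof.
move=> e; apply/eqP; rewrite -subr_eq0; apply/eqP.
apply: (tensor_separated (phi := fun v (f : R) => f v)) => [v|f f0|v].
- exact: repfun_eval_linear.
- by apply: repfun_ext => v; rewrite f0.
- have /= -> := linear_mapB (tlift_linear (tens_at_bilinear v)) t t'.
  by apply/eqP; rewrite subr_eq0; apply/eqP; apply: e.
Qed.

(** Slicing the second factor at w leaves an element of R(g), which is then tested at every v. *)
Lemma eval2_separated (t : tensor R R) :
  (forall v w, tlift (fun f1 f2 : R => (f1 v : F) * f2 w : F^o) t = 0) -> t = 0.
Proof.
move=> t0.
apply: (tensor_separated (phi := fun w (f : R) => f w)) => [w|f f0|w].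
- exact: repfun_eval_linear.
- by apply: repfun_ext => v; rewrite f0.
- apply: repfun_ext => v; rewrite -[RHS](t0 v w) {t0}.
  have sl := slice_bilinear R (@repfun_eval_linear F g w).
  move: t; apply: tens_linear_ext.
  + exact: linear_map_comp (@repfun_eval_linear _ _ v) (tlift_linear sl).
  + exact: tlift_linear (eval2_bilinear v w).
  + move=> f1 f2; rewrite (tlift_tens sl) (tlift_tens (eval2_bilinear v w)).
    by rewrite (linear_mapZ (repfun_eval_linear v)) mulrC.
Qed.

Lemma tens_at2_inj (t t' : tensor M (tensor R R)) :
  (forall v w : U,
     let ev := tlift (fun m (x : tensor R R) =>
       (tlift (fun f1 f2 : R => (f1 v : F) * f2 w : F^o) x : F) *: m) in
     ev t = ev t') -> t = t'.
Proof.
move=> e; apply/eqP; rewrite -subr_eq0; apply/eqP.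
have el (p : U * U) := tlift_linear (eval2_bilinear p.1 p.2).
apply: (tensor_separated el) => [x x0|[v w]].
- by apply: eval2_separated => v w; apply: (x0 (v, w)).
- rewrite (linear_mapB (tlift_linear (slice_bilinear M (el (v, w))))).
  by apply/eqP; rewrite subr_eq0; apply/eqP; apply: e.
Qed.

End Evaluation.

(** * The coaction of a locally finite module *)

Section LocallyFinite.
Variables (F : fieldType) (g : lieAlgType F) (M : lmodType F).
Variable act : g -> M -> M.
Hypothesis act_mod : is_lie_module act.

Lemma finite_dim_locally_finite (V : vectType F) (a : g -> V -> V) :
  locally_finite a.
Proof.
move=> m; exists (\dim {:V}), (fun i => (vbasis {:V})`_i) => span.
have spanT p : span p.
  by exists (fun i => coord (vbasis fullv) i p); apply: coord_vbasis (memvf p).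
by split=> [|x p _]; apply: spanT.
Qed.

Let invariant_span (n : nat) (e : 'I_n -> M) (m : M) :=
  (exists c : 'I_n -> F, m = \sum_i c i *: e i) /\
  forall x p, (exists c : 'I_n -> F, p = \sum_i c i *: e i) ->
    exists c : 'I_n -> F, act x p = \sum_i c i *: e i.

(* A spanning family of minimal size is linearly independent. *)
Lemma locally_finite_basis (m : M) : locally_finite act ->
  exists (n : nat) (e : 'I_n -> M), invariant_span e m /\
    forall c, \sum_i c i *: e i = 0 -> forall i, c i = 0 :> F.
Proof.
move=> lf; pose P n := `[< exists e : 'I_n -> M, invariant_span e m >].
have exP : exists n, P n by have [n [e he]] := lf m; exists n; apply/asboolP; exists e.
have [n /asboolP[e [me inve]] nmin] := ex_minnP exP.
exists n, e; split=> // c ce0 j; apply/eqP/negPn/negP => cj.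
case: n e me inve nmin c ce0 j cj => [|n] e me inve nmin c ce0 j cj; first by case: j cj.
suff /nmin : P n by rewrite ltnn.
have sub p : (exists c, p = \sum_i c i *: e i) ->
    exists c, p = \sum_i c i *: e (lift j i).
  move=> [d ->].
  have ej : e j = \sum_i (- ((c j)^-1 * c (lift j i))) *: e (lift j i).
    move: ce0; rewrite (bigD1_ord j) //= => /eqP; rewrite addr_eq0 => /eqP ce.
    rewrite -[LHS]scale1r -(mulVf cj) -scalerA ce scalerN scaler_sumr -sumrN.
    by apply: eq_bigr => i _; rewrite scalerA scaleNr.
  exists (fun i => d (lift j i) - d j * ((c j)^-1 * c (lift j i))).
  rewrite (bigD1_ord j) //= {1}ej scaler_sumr -big_split /=.
  by apply: eq_bigr => i _; rewrite scalerA -scalerDl addrC mulrN.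
have sup p : (exists c, p = \sum_i c i *: e (lift j i)) ->
    exists c, p = \sum_i c i *: e i.
  move=> [d ->]; exists (fun i => if unlift j i is Some k then d k else 0).
  rewrite (bigD1_ord j) //= unlift_none scale0r add0r.
  by apply: eq_bigr => i _; rewrite liftK.
apply/asboolP; exists (fun i => e (lift j i)); split; first exact: sub.
by move=> x p /sup/(inve x)/sub.
Qed.

(** The matrix coefficients of U(g) on an invariant span satisfy c_ij(v w) = sum over k of c_ik(w)
    c_kj(v). Hence they have finite rank and belong to R(g), and they are the second tensor
    factors. *)
Lemma locally_finite_coaction : locally_finite act ->
  forall m, exists t : tensor M (repfun g), forall v, tens_at t v = uact act v m.
Proof.
move=> lf m; have [n [e [[[d me] inve] free]]] := locally_finite_basis m lf.
(* Linear independence makes the coefficients unique; this is why the chosen functions of v turn out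
   linear and multiplicative. *)
have coef_inj (c c' : 'I_n -> F) :
    \sum_i c i *: e i = \sum_i c' i *: e i -> forall i, c i = c' i.
  move=> ecc' i; apply/eqP; rewrite -subr_eq0; apply/eqP.
  apply: (free (fun i => c i - c' i)).
  rewrite (eq_bigr (fun i => c i *: e i - c' i *: e i)); last first.
    by move=> k _; rewrite scalerBl.
  by rewrite sumrB ecc' subrr.
have Uinv v p : (exists c, p = \sum_i c i *: e i) ->
    exists c, uact act v p = \sum_i c i *: e i.
  elim/uenv_left_ind: v => [|a u ih|u v ihu ihv|x u ih] sp.
  - by rewrite uact1.
  - rewrite (linear_mapZ (uact_linearl act_mod p)).
    have [c ->] := ih sp; exists (fun i => a * c i); rewrite scaler_sumr.
    by apply: eq_bigr => i _; rewrite scalerA.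
  - rewrite (linear_mapD (uact_linearl act_mod p)).
    have [c ->] := ihu sp; have [c' ->] := ihv sp; exists (fun i => c i + c' i).
    by rewrite -big_split; apply: eq_bigr => i _; rewrite scalerDl.
  - by rewrite uact_uinjM //; apply/inve/ih.
have ex_coef (vi : uenv g * 'I_n) :
    exists c : 'I_n -> F, uact act vi.1 (e vi.2) = \sum_j c j *: e j.
  apply: Uinv; exists (fun j => (j == vi.2)%:R).
  rewrite (bigD1 vi.2) //= eqxx scale1r big1 ?addr0 // => j /negPf ->.
  by rewrite scale0r.
have [c' c'P] := choice ex_coef; pose c v i := c' (v, i).
have cP v i : uact act v (e i) = \sum_j c v i j *: e j by apply: (c'P (v, i)).
have cl j i : linear (fun v => c v i j : F^o).
  move=> a u v; move: j; apply: (@coef_inj (c (a *: u + v) i)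
    (fun j => a * c u i j + c v i j)).
  rewrite -cP (uact_linearl act_mod (e i)) !cP scaler_sumr -big_split /=.
  by apply: eq_bigr => j _; rewrite scalerDl scalerA.
have cM v w i j : c (v * w) i j = \sum_k c w i k * c v k j.
  move: j; apply: coef_inj.
  rewrite -cP (uactM act_mod) cP (linear_map_sum _ _ _ (uact_linearr act_mod v)).
  transitivity (\sum_k \sum_j (c w i k * c v k j) *: e j).
    apply: eq_bigr => k _; rewrite (linear_mapZ (uact_linearr act_mod v)) cP.
    by rewrite scaler_sumr; apply: eq_bigr => j _; rewrite scalerA.
  by rewrite exchange_big; apply: eq_bigr => j _; rewrite scaler_suml.
have crep i j : is_representative (fun v => c v i j : F^o).
  apply: finite_rank_is_representative; first exact: cl.
  exists 'I_n, (fun k v => c v k j), (fun k w => c w i k) => v w.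
  by rewrite cM; apply: eq_bigr => k _; rewrite mulrC.
exists (\sum_j \sum_i d i *: tens (e j) (to_repfun (fun v => c v i j : F^o))) => v.
have el := @tens_at_linear F g M v.
rewrite me (linear_map_sum _ _ _ el) (linear_map_sum _ _ _ (uact_linearr act_mod v)).
transitivity (\sum_j \sum_i (d i * c v i j) *: e j).
  apply: eq_bigr => j _; rewrite (linear_map_sum _ _ _ el).
  apply: eq_bigr => i _; rewrite (linear_mapZ el) tens_at_tens.
  by rewrite (to_repfunE _ (crep i j)) scalerA.
rewrite exchange_big; apply: eq_bigr => i _.
rewrite (linear_mapZ (uact_linearr act_mod v)) cP scaler_sumr.
by apply: eq_bigr => j _; rewrite scalerA.
Qed.

End LocallyFinite.

(* Identities between signed sums in an abelian group: the first term is
   cancelled against its opposite, which is first moved to the second place. *)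
Ltac zmod_eq :=
  apply/eqP; rewrite -subr_eq0; apply/eqP;
  apply: (etrans (esym (addr0 _)));
  rewrite ?(opprD, opprK) -?addrA;
  repeat lazymatch goal with
  | |- - ?x + _ = _ => first [rewrite (addKr x) | rewrite (addrCA _ x)]
  | |- ?x + _ = _ => first [rewrite (addNKr x) | rewrite (addrCA _ (- x))]
  end; reflexivity.

(** * The action of [g1] on pairs *)

Section PairAction.
Variables (F : fieldType) (g1 g2 : lieAlgType F) (mp : matched_pair g1 g2).
Local Notation U1 := (uenv g1).
Local Notation U2 := (uenv g2).
Local Notation T := (tensor (uenv g1) (uenv g2)).
Local Notation e2 := (vbasis (fullv : {vspace g2})).
Local Notation d2 := (\dim (fullv : {vspace g2})).

Lemma mpl_linearl X : linear (fun z => mpl mp z X).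
Proof. exact: lie_module_linearl (mpl_module mp) X. Qed.

Lemma mpl_linearr z : linear (mpl mp z).
Proof. exact: lie_module_linearr (mpl_module mp) z. Qed.

Lemma mpr_linearl X : linear (fun z => mpr mp z X).
Proof. by case: (mpr_bilinear mp) => rl _; apply: rl. Qed.

Lemma mpr_linearr z : linear (mpr mp z).
Proof. by case: (mpr_bilinear mp) => _ rr; apply: rr. Qed.

Definition g1act (X : g1) (w : T) : T := (tens (uinj X) 1 : T) * w.

Lemma g1act_tens X u v : g1act X (tens u v) = tens (uinj X * u) v.
Proof. by rewrite /g1act mul_tens mul1r. Qed.

Lemma g1act_linearl w : linear (fun X => g1act X w).
Proof.
move=> c X Y; rewrite /g1act (uinj_linear c) (@tens_linearl F U1 U2 1 c).
by rewrite mulrDl -scalerAl.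
Qed.

Lemma g1act_linearr X : linear (g1act X).
Proof. exact: linear_map_mull. Qed.

Lemma g1act_module : is_lie_module g1act.
Proof.
split=> [|X Y w].
  by split=> [w|X]; [apply: g1act_linearl|apply: g1act_linearr].
rewrite /g1act uinj_lie (linear_mapB (@tens_linearl F U1 U2 1)) mulrBl !mulrA.
by rewrite !mul_tens mul1r.
Qed.

Lemma tensor_left_ind (P : T -> Prop) :
  (forall c w, P w -> P (c *: w)) -> (forall w w', P w -> P w' -> P (w + w')) ->
  (forall v, P (tens 1 v)) -> (forall X w, P w -> P (g1act X w)) ->
  forall w, P w.
Proof.
move=> PZ PD P1 PM; apply: tens_ind => //.
- by rewrite -(linear_map0 (tens_linearr 1)); apply: P1.
- move=> u v; elim/uenv_left_ind: u => [|c u ih|u u' ih ih'|X u ih].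
  + exact: P1.
  + by rewrite (linear_mapZ (@tens_linearl F U1 U2 v)); apply: PZ.
  + by rewrite (linear_mapD (@tens_linearl F U1 U2 v)); apply: PD.
  + by rewrite -g1act_tens; apply: PM.
Qed.

(* The pair (w, phi) stands for w in U(g1) (x) U(g2) together with the linear
   map z |-> z w prescribed by its values on a basis of g2; g1 acts on such
   pairs as forced by z X = X z + (z |> X) + (z <| X). *)
Local Notation Q := (T * ('I_d2 -> T))%type.

(** Any family of values on a basis is allowed, so the pairs form a plain product of modules, with
    no linearity condition to maintain. *)
Definition basis_ext (phi : 'I_d2 -> T) (z : g2) : T :=
  \sum_i coord e2 i z *: phi i.

Lemma basis_ext_linear phi : linear (basis_ext phi).
Proof.
apply: linear_map_sumf => i; apply: linear_map_scalel.
exact: linearP.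
Qed.

Lemma basis_ext_linearl z : linear (basis_ext^~ z).
Proof.
by apply: linear_map_sumf => i; apply: linear_map_scale.
Qed.

Lemma basis_ext_vbasis (f : g2 -> T) z :
  linear f -> basis_ext (fun i => f e2`_i) z = f z.
Proof. by move=> fl; rewrite [RHS](linear_map_vbasis _ fl). Qed.

Lemma basis_ext_nth phi (i : 'I_d2) : basis_ext phi e2`_i = phi i.
Proof.
rewrite /basis_ext (bigD1 i) //= big1 ?addr0 => [|j ij].
  by rewrite coord_free ?(basis_free (vbasisP _)) // eqxx scale1r.
rewrite coord_free ?(basis_free (vbasisP _)) //.
by rewrite eq_sym [_ == _](negPf ij) scale0r.
Qed.

Definition pair_act (X : g1) (q : Q) : Q :=
  (g1act X q.1,
   fun i => g1act X (q.2 i) + g1act (mpl mp e2`_i X) q.1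
            + basis_ext q.2 (mpr mp e2`_i X)).

Lemma basis_ext_pair_act X q z :
  basis_ext (pair_act X q).2 z =
  g1act X (basis_ext q.2 z) + g1act (mpl mp z X) q.1 + basis_ext q.2 (mpr mp z X).
Proof.
pose f z := g1act X (basis_ext q.2 z) + g1act (mpl mp z X) q.1
            + basis_ext q.2 (mpr mp z X).
rewrite -[RHS]/(f z) -[RHS]basis_ext_vbasis.
  by congr basis_ext; apply: funext => i; rewrite /f basis_ext_nth.
apply: linear_map_add; last first.
  exact: linear_map_comp (basis_ext_linear _) (mpr_linearl X).
apply: linear_map_add.
  exact: linear_map_comp (g1act_linearr X) (basis_ext_linear _).
exact: linear_map_comp (g1act_linearl _) (mpl_linearl X).
Qed.

Lemma pair_ext (q q' : Q) : q.1 = q'.1 ->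
  (forall z, basis_ext q.2 z = basis_ext q'.2 z) -> q = q'.
Proof.
case: q q' => [w phi] [w' phi'] /= -> e; congr (_, _); apply: funext => i.
by rewrite -[LHS]basis_ext_nth -[RHS]basis_ext_nth e.
Qed.

(** On the second component, the terms left over by the bracket [X, Y] cancel by the compatibility
    of |> with brackets of [g1] and by <| being a right action. *)
Lemma pair_act_module : is_lie_module pair_act.
Proof.
split; [split|] => [q c X Y|X c q q'|X Y q]; apply: pair_ext => [|z] //.
- exact: g1act_linearl.
- rewrite (basis_ext_linearl z c (pair_act X q).2 (pair_act Y q).2).
  rewrite !basis_ext_pair_act (g1act_linearl _ c) (mpl_linearr z).
  rewrite (g1act_linearl q.1 c) (mpr_linearr z) (basis_ext_linear q.2 c).
  by rewrite !scalerDr; zmod_eq.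
- exact: g1act_linearr.
- rewrite (basis_ext_linearl z c (pair_act X q).2 (pair_act X q').2).
  rewrite !basis_ext_pair_act /=.
  rewrite !(basis_ext_linearl _ c q.2 q'.2) !(g1act_linearr _ c).
  by rewrite !scalerDr; zmod_eq.
- by case: g1act_module => _; apply.
- rewrite (linear_mapB (basis_ext_linearl z) (pair_act X (pair_act Y q)).2
    (pair_act Y (pair_act X q)).2).
  rewrite !basis_ext_pair_act /=.
  rewrite !(linear_mapD (g1act_linearr _)).
  have [_ g1actL] := g1act_module.
  rewrite g1actL mpl_compat mpr_lie.
  rewrite (linear_mapB (basis_ext_linear q.2)) (linear_mapB (g1act_linearl q.1)).
  rewrite !(linear_mapD (g1act_linearl q.1)) !g1actL.
  zmod_eq.
Qed.

End PairAction.

(** * The action on U(g1) (x) U(g2) and injectivity of multiplication *)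

Section Factorization.
Variables (F : fieldType) (g1 g2 : lieAlgType F) (mp : matched_pair g1 g2).
Local Notation U1 := (uenv g1).
Local Notation U2 := (uenv g2).
Local Notation T := (tensor (uenv g1) (uenv g2)).
Local Notation e2 := (vbasis (fullv : {vspace g2})).
Local Notation d2 := (\dim (fullv : {vspace g2})).
Local Notation Q := (T * ('I_d2 -> T))%type.

(** The start of the recursion: z acts on 1 (x) v by left multiplication in U(g2). *)
Definition pair_init (v : U2) : Q :=
  (tens 1 v, fun i : 'I_d2 => tens 1 (uinj e2`_i * v)).

Lemma basis_ext_pair_init v z :
  basis_ext (pair_init v).2 z = tens 1 (uinj z * v) :> T.
Proof.
apply: (basis_ext_vbasis (f := fun z => tens 1 (uinj z * v) : T)) => c x y.
by rewrite (uinj_linear c) mulrDl -scalerAl (@tens_linearr F U1 U2 1 c).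
Qed.

Lemma uact_pair_act1 u v : (uact (pair_act mp) u (pair_init v)).1 = tens u v.
Proof.
have pm := pair_act_module mp.
elim/uenv_left_ind: u => [|c u ih|u u' ih ih'|X u ih].
- by rewrite uact1.
- rewrite (linear_mapZ (uact_linearl pm (pair_init v))) -[LHS]/(c *: _.1) ih.
  by rewrite (linear_mapZ (@tens_linearl F U1 U2 v)).
- rewrite (linear_mapD (uact_linearl pm (pair_init v))) -[LHS]/(_.1 + _.1) ih ih'.
  by rewrite (linear_mapD (@tens_linearl F U1 U2 v)).
- by rewrite uact_uinjM // /= ih g1act_tens.
Qed.

(** By [uact_pair_act1] the pair reached from [pair_init v] by u has first component u (x) v, so its
    second component is the prescribed value of z on u (x) v. *)
Definition g2act (z : g2) (w : T) : T :=
  tlift (fun u v => basis_ext (uact (pair_act mp) u (pair_init v)).2 z) w.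

Let g2act_bilinear z : bilinear_map
  (fun (u : U1) (v : U2) => basis_ext (uact (pair_act mp) u (pair_init v)).2 z).
Proof.
have pm := pair_act_module mp.
split=> [v c u u'|u c v v'].
- by rewrite (uact_linearl pm (pair_init v)) -(basis_ext_linearl z).
- have -> : pair_init (c *: v + v') = c *: pair_init v + pair_init v'.
    congr (_, _); first exact: tens_linearr.
    apply: funext => i; rewrite mulrDr -scalerAr.
    exact: (@tens_linearr F U1 U2 1 c).
  by rewrite (uact_linearr pm u) -(basis_ext_linearl z).
Qed.

Lemma g2act_tens z u v :
  g2act z (tens u v) = basis_ext (uact (pair_act mp) u (pair_init v)).2 z.
Proof. exact: tlift_tens. Qed.

Lemma g2act_linearr z : linear (g2act z).
Proof. exact: tlift_linear. Qed.

Lemma g2act_linearl w : linear (g2act^~ w).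
Proof.
by apply: tlift_fun_linear => // u v; apply: basis_ext_linear.
Qed.

Lemma g2act_tens1 z v : g2act z (tens 1 v) = tens 1 (uinj z * v).
Proof.
by rewrite g2act_tens uact1 ?basis_ext_pair_init //; apply: pair_act_module.
Qed.

Lemma g2act_g1act z X w :
  g2act z (g1act X w) = g1act X (g2act z w) + g1act (mpl mp z X) w + g2act (mpr mp z X) w.
Proof.
have ll := @g1act_linearr F g1 g2.
move: w; apply: tens_linear_ext => [||u v].
- exact: linear_map_comp (g2act_linearr z) (ll X).
- apply: linear_map_add; last exact: g2act_linearr.
  apply: linear_map_add; last exact: ll.
  exact: linear_map_comp (ll X) (g2act_linearr z).
rewrite g1act_tens !g2act_tens uact_uinjM; last exact: pair_act_module.
by rewrite basis_ext_pair_act uact_pair_act1.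
Qed.

Lemma g2act_mulr z w n : g2act z (w * tens 1 n) = g2act z w * tens 1 n.
Proof.
elim/tensor_left_ind: w z => [c w ih|w w' ih ih'|v|X w ih] z.
- by rewrite -scalerAl !(linear_mapZ (g2act_linearr z)) -scalerAl ih.
- by rewrite mulrDl !(linear_mapD (g2act_linearr z)) mulrDl ih ih'.
- by rewrite mul_tens mul1r !g2act_tens1 mul_tens mul1r mulrA.
- have lA Y x : g1act Y x * tens 1 n = g1act Y (x * tens 1 n) by rewrite /g1act mulrA.
  by rewrite lA !g2act_g1act !mulrDl !lA !ih.
Qed.

(** On 1 (x) v this is associativity in U(g2). Passing from w to X w uses the other two bracket
    axioms of a matched pair, |> being an action and the compatibility of <| with brackets of [g2].
    It calls the hypothesis at z <| X, hence the induction over all z and x at once. *)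
Lemma g2act_module : is_lie_module g2act.
Proof.
split=> [|z x w]; first by split=> [w|z]; [apply: g2act_linearl|apply: g2act_linearr].
have rl := g2act_linearr; have ll := @g1act_linearr F g1 g2.
elim/tensor_left_ind: w z x => [c w ih|w w' ih ih'|v|X w ih] z x.
- by rewrite !(linear_mapZ (rl _)) ih scalerBr.
- by rewrite !(linear_mapD (rl _)) ih ih'; zmod_eq.
- rewrite !g2act_tens1 uinj_lie mulrBl (linear_mapB (@tens_linearr F U1 U2 1)).
  by rewrite !mulrA.
- rewrite !g2act_g1act !(linear_mapD (rl _)) !g2act_g1act ih (linear_mapB (ll X)).
  rewrite (mpl_module mp).2 mpr_compat.
  rewrite (linear_mapB (g1act_linearl w)) (linear_mapB (g2act_linearl w)).
  rewrite !(linear_mapD (g2act_linearl w)) !ih.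
  zmod_eq.
Qed.

Definition dcact (y : dcsum mp) (w : T) : T := g1act y.1 w + g2act y.2 w.

Lemma dcact_module : is_lie_module dcact.
Proof.
have rl := g2act_linearr; have ll := @g1act_linearr F g1 g2.
split=> [|y y' w].
  split=> [w c y y'|y].
    by rewrite /dcact /= (g1act_linearl w c) (g2act_linearl w c) !scalerDr; zmod_eq.
  exact: linear_map_add (ll _) (rl _).
rewrite /dcact /= !(linear_mapB (g1act_linearl w), linear_mapD (g1act_linearl w)).
rewrite !(linear_mapB (g2act_linearl w), linear_mapD (g2act_linearl w)).
rewrite !(linear_mapD (ll _), linear_mapD (rl _)) !g2act_g1act.
rewrite (@g1act_module F g1 g2).2 g2act_module.2.
zmod_eq.
Qed.

Lemma dcinl_linear : linear (@dcinl F g1 g2 mp).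
Proof. by move=> c X Y; congr (_, _); rewrite /= ?scaler0 ?addr0. Qed.

Lemma dcinr_linear : linear (@dcinr F g1 g2 mp).
Proof. by move=> c X Y; congr (_, _); rewrite /= ?scaler0 ?addr0. Qed.

Lemma lie_dcinl X Y : lie (dcinl mp X) (dcinl mp Y) = dcinl mp (lie X Y).
Proof.
congr (_, _) => /=.
- by rewrite (linear_map0 (mpl_linearl mp X)) (linear_map0 (mpl_linearl mp Y))
    subr0 addr0.
- rewrite (linear_map0 (mpr_linearl mp X)) (linear_map0 (mpr_linearl mp Y)) subr0 addr0.
  exact: liexx.
Qed.

Lemma lie_dcinr z x : lie (dcinr mp z) (dcinr mp x) = dcinr mp (lie z x).
Proof.
congr (_, _) => /=.
- rewrite (linear_map0 (mpl_linearr mp z)) (linear_map0 (mpl_linearr mp x)) subr0 addr0.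
  exact: liexx.
- by rewrite (linear_map0 (mpr_linearr mp z)) (linear_map0 (mpr_linearr mp x))
    subr0 addr0.
Qed.

Lemma lie_dcinr_dcinl z X :
  lie (dcinr mp z) (dcinl mp X) = dcinl mp (mpl mp z X) + dcinr mp (mpr mp z X).
Proof.
congr (_, _) => /=.
- rewrite (linear_map0 (mpl_linearl mp _)) subr0 addr0.
  by rewrite -(scale0r 0) lieZl scale0r add0r.
- rewrite (linear_map0 (mpr_linearl mp _)) subr0 add0r.
  by rewrite -(scale0r 0) lieZr scale0r add0r.
Qed.

Lemma uinl_lie_hom : is_lie_hom (fun X => uinj (dcinl mp X)).
Proof.
split=> [c X Y|X Y]; last by rewrite -lie_dcinl uinj_lie.
by rewrite dcinl_linear (uinj_linear c).
Qed.

Lemma uinr_lie_hom : is_lie_hom (fun z => uinj (dcinr mp z)).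
Proof.
split=> [c X Y|X Y]; last by rewrite -lie_dcinr uinj_lie.
by rewrite dcinr_linear (uinj_linear c).
Qed.

Lemma uinl_uinj X : uinl mp (uinj X) = uinj (dcinl mp X).
Proof. exact: ulift_uinj uinl_lie_hom X. Qed.

Lemma uinr_uinj z : uinr mp (uinj z) = uinj (dcinr mp z).
Proof. exact: ulift_uinj uinr_lie_hom z. Qed.

Lemma uinlM u v : uinl mp (u * v) = uinl mp u * uinl mp v.
Proof. exact: uliftM uinl_lie_hom u v. Qed.

Lemma uinrM u v : uinr mp (u * v) = uinr mp u * uinr mp v.
Proof. exact: uliftM uinr_lie_hom u v. Qed.

Lemma uinl1 : uinl mp 1 = 1.
Proof. exact: ulift1 uinl_lie_hom. Qed.

Lemma uinr1 : uinr mp 1 = 1.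
Proof. exact: ulift1 uinr_lie_hom. Qed.

Lemma uinl_linear : linear (uinl mp).
Proof. exact: ulift_linear uinl_lie_hom. Qed.

Lemma uinr_linear : linear (uinr mp).
Proof. exact: ulift_linear uinr_lie_hom. Qed.

Let umult_bilinear :
  bilinear_map (fun (u : U1) (v : U2) => uinl mp u * uinr mp v).
Proof.
split=> [v c u u'|u c v v'].
- by rewrite (uinl_linear c) mulrDl -scalerAl.
- by rewrite (uinr_linear c) mulrDr -scalerAr.
Qed.

Lemma umult_tens u v : umult mp (tens u v) = uinl mp u * uinr mp v.
Proof. exact: tlift_tens. Qed.

Lemma umult_linear : linear (umult mp).
Proof. exact: tlift_linear. Qed.

(** The product u v moves 1 (x) 1 to u (x) v, so acting on this vector is a left inverse of
    multiplication. *)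
Lemma uact_umult t : uact dcact (umult mp t) (tens 1 1) = t.
Proof.
have dm := dcact_module; have dl := uact_linearl dm.
move: t; apply: tens_linear_ext => [||u v] //.
  exact: linear_map_comp (dl _) umult_linear.
rewrite umult_tens uactM //.
have -> : uact dcact (uinr mp v) (tens 1 1) = tens 1 v.
  elim/uenv_left_ind: v => [|c v ih|v v' ih ih'|z v ih].
  - by rewrite uinr1 uact1.
  - rewrite (linear_mapZ uinr_linear) (linear_mapZ (dl _)) ih.
    by rewrite (linear_mapZ (@tens_linearr F U1 U2 1)).
  - rewrite (linear_mapD uinr_linear) (linear_mapD (dl _)) ih ih'.
    by rewrite (linear_mapD (@tens_linearr F U1 U2 1)).
  - rewrite uinrM uinr_uinj uact_uinjM // ih /dcact /= g2act_tens1.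
    by rewrite (linear_map0 (@g1act_linearl F g1 g2 _)) add0r.
elim/uenv_left_ind: u => [|c u ih|u u' ih ih'|X u ih].
- by rewrite uinl1 uact1.
- rewrite (linear_mapZ uinl_linear) (linear_mapZ (dl _)) ih.
  by rewrite (linear_mapZ (@tens_linearl F U1 U2 v)).
- rewrite (linear_mapD uinl_linear) (linear_mapD (dl _)) ih ih'.
  by rewrite (linear_mapD (@tens_linearl F U1 U2 v)).
- rewrite uinlM uinl_uinj uact_uinjM // ih /dcact /= g1act_tens.
  by rewrite (linear_map0 (g2act_linearl _)) addr0.
Qed.

Lemma umult_inj : injective (umult mp).
Proof. by move=> t t' e; rewrite -(uact_umult t) e uact_umult. Qed.

Lemma umult_g1act X w : umult mp (g1act X w) = uinj (dcinl mp X) * umult mp w.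
Proof.
move: w; apply: tens_linear_ext => [||u v].
- exact: linear_map_comp umult_linear (@g1act_linearr F g1 g2 X).
- exact: linear_map_comp (@linear_map_mull _ _ _) umult_linear.
- by rewrite g1act_tens !umult_tens uinlM uinl_uinj mulrA.
Qed.

Lemma umult_g2act z w : umult mp (g2act z w) = uinj (dcinr mp z) * umult mp w.
Proof.
elim/tensor_left_ind: w z => [c w ih|w w' ih ih'|v|X w ih] z.
- by rewrite (linear_mapZ (g2act_linearr z)) !(linear_mapZ umult_linear) ih scalerAr.
- by rewrite (linear_mapD (g2act_linearr z)) !(linear_mapD umult_linear) ih ih' mulrDr.
- by rewrite g2act_tens1 !umult_tens uinl1 !mul1r uinrM uinr_uinj.
- rewrite g2act_g1act !(linear_mapD umult_linear) !umult_g1act !ih.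
  rewrite -addrA -mulrDl -(linear_mapD (@uinj_linear _ _)) -lie_dcinr_dcinl.
  by rewrite uinj_lie mulrBl !mulrA addrC subrK.
Qed.

Lemma umult_uact v w : umult mp (uact g2act v w) = uinr mp v * umult mp w.
Proof.
have rm := g2act_module; have rl := uact_linearl rm w.
elim/uenv_left_ind: v => [|c v ih|v v' ih ih'|z v ih].
- by rewrite uinr1 uact1 // mul1r.
- by rewrite (linear_mapZ uinr_linear) (linear_mapZ rl) (linear_mapZ umult_linear)
    ih scalerAl.
- by rewrite (linear_mapD uinr_linear) (linear_mapD rl) (linear_mapD umult_linear)
    ih ih' mulrDl.
- by rewrite uact_uinjM // umult_g2act ih uinrM uinr_uinj mulrA.
Qed.

(** Letting v act on u (x) 1 produces an explicit preimage of v u. The default in [upsi] is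
    therefore not reached, and injectivity identifies the chosen preimage with this one. *)
Lemma upsiE v u : upsi mp v u = uact g2act v (tens u 1).
Proof.
apply: umult_inj; rewrite umult_uact umult_tens uinr1 mulr1.
have := @xgetPex _ 0 [set t | umult mp t = uinr mp v * uinl mp u]%classic.
apply; exists (uact g2act v (tens u 1)).
by rewrite /= umult_uact umult_tens uinr1 mulr1.
Qed.

End Factorization.

(** * Explicit formulas for v |> X and v <| X *)

Section MutualActions.
Variables (F : fieldType) (g1 g2 : lieAlgType F) (mp : matched_pair g1 g2).
Local Notation U1 := (uenv g1).
Local Notation U2 := (uenv g2).
Local Notation T := (tensor (uenv g1) (uenv g2)).
Local Notation p1 :=
  (tlift (fun (u' : uenv g1) (v' : uenv g2) => (ucounit v' : F) *: u')).
Local Notation p2 :=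
  (tlift (fun (u' : uenv g1) (v' : uenv g2) => (ucounit u' : F) *: v')).

Let p1_bilinear :
  bilinear_map (fun (u' : U1) (v' : U2) => (ucounit v' : F) *: u').
Proof. exact: slice_bilinear (@ucounit_linear F g2). Qed.

Let p2_bilinear :
  bilinear_map (fun (u' : U1) (v' : U2) => (ucounit u' : F) *: v').
Proof.
split=> [v'|u' c x y].
  exact: linear_map_scalel (@ucounit_linear F g1).
by rewrite scalerDr !scalerA mulrC.
Qed.

Let p1l := tlift_linear p1_bilinear.
Let p2l := tlift_linear p2_bilinear.

Let p2_tens1 v : p2 (tens 1 v) = v.
Proof. by rewrite tlift_tens // ucounit1 scale1r. Qed.

Let p2_g1act X (w : T) : p2 (g1act X w) = 0.
Proof.
move: w; apply: tens_linear_ext => [||u v].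
- exact: linear_map_comp p2l (@g1act_linearr F g1 g2 X).
- by move=> c x y; rewrite scaler0 addr0.
- by rewrite g1act_tens tlift_tens // ucounitM ucounit_uinj mul0r scale0r.
Qed.

Let p2_mulr n (w : T) : p2 (w * tens 1 n) = p2 w * n.
Proof.
move: w; apply: tens_linear_ext => [||u v].
- exact: linear_map_comp p2l (@linear_map_mulr _ _ _).
- exact: linear_map_comp (@linear_map_mulr _ _ _) p2l.
- by rewrite mul_tens mulr1 !tlift_tens // -scalerAl.
Qed.

Let ucounit_p2_g2act z (w : T) : ucounit (p2 (g2act mp z w)) = 0.
Proof.
have rl := g2act_linearr mp; have cl := @ucounit_linear F g2.
elim/tensor_left_ind: w z => [c w ih|w w' ih ih'|v|X w ih] z.
- rewrite (linear_mapZ (rl z)) (linear_mapZ p2l) (linear_mapZ cl) ih.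
  exact: scaler0.
- rewrite (linear_mapD (rl z)) (linear_mapD p2l) (linear_mapD cl) ih ih'.
  exact: addr0.
- by rewrite g2act_tens1 p2_tens1 ucounitM ucounit_uinj mul0r.
- by rewrite g2act_g1act !(linear_mapD p2l) !p2_g1act !add0r ih.
Qed.

Lemma umprE v u : umpr mp v u = p2 (uact (g2act mp) v (tens u 1)).
Proof. by rewrite /umpr upsiE. Qed.

Lemma umpr_linearl u : linear (fun v => umpr mp v u).
Proof.
move=> c v v'; rewrite !umprE (uact_linearl (g2act_module mp) _ c).
exact: p2l.
Qed.

Lemma umpr_linearr v : linear (umpr mp v).
Proof.
move=> c u u'; rewrite !umprE (@tens_linearl F U1 U2 1 c).
by rewrite (uact_linearr (g2act_module mp) v c) p2l.
Qed.

(** This makes the term 1 (x) (v <| X) of Psi(v (x) X) invisible to id (x) epsilon. *)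
Lemma ucounit_umpr v X : ucounit (umpr mp v (uinj X)) = 0.
Proof.
have cl := @ucounit_linear F g2; have ul := umpr_linearl (uinj X).
elim/uenv_left_ind: v => [|c v ih|v v' ih ih'|z v ih].
- rewrite umprE uact1; last exact: g2act_module.
  by rewrite tlift_tens // ucounit_uinj scale0r ucounit0.
- by rewrite (linear_mapZ ul) (linear_mapZ cl) ih; apply: scaler0.
- by rewrite (linear_mapD ul) (linear_mapD cl) ih ih'; apply: addr0.
- rewrite umprE uact_uinjM ?ucounit_p2_g2act //; exact: g2act_module.
Qed.

(* (c_(1) |> X) (x) c_(2), for c in U(g2) (x) U(g2) *)
Definition tens_umpl (X : g1) (c : tensor U2 U2) : T :=
  tlift (fun a b => tens (uinj (uact (mpl mp) a X)) b) c.

Let tens_umpl_bilinear X :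
  bilinear_map (fun (a b : U2) => tens (uinj (uact (mpl mp) a X)) b : T).
Proof.
split=> [b c x y|a]; last exact: tens_linearr.
rewrite (uact_linearl (mpl_module mp) X c) (uinj_linear c).
exact: tens_linearl.
Qed.

Lemma tens_umpl_tens X a b :
  tens_umpl X (tens a b) = g1act (uact (mpl mp) a X) (tens 1 b).
Proof. by rewrite /tens_umpl tlift_tens // g1act_tens mulr1. Qed.

Lemma tens_umpl_linear X : linear (tens_umpl X).
Proof. exact: tlift_linear. Qed.

(** Moving z past a |> X gives z |> (a |> X) and (a |> X) z, which is the coproduct of z acting on
    c, plus a term in 1 (x) U(g2). That term is kept anonymous because a projection identifies it
    later. *)
Lemma g2act_tens_umpl z X c : exists b,
  g2act mp z (tens_umpl X c) =
    tens_umpl X ((tens (uinj z) 1 + tens 1 (uinj z)) * c) + tens 1 b.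
Proof.
have rl := g2act_linearr mp z; have tl := tens_umpl_linear X.
elim/tens_ind: c => [|a b|c c' [b ih] [b' ih']|k c [b ih]].
- exists 0; rewrite mulr0 (linear_map0 tl) (linear_map0 rl).
  by rewrite (linear_map0 (tens_linearr _)) addr0.
- exists (uinj (mpr mp z (uact (mpl mp) a X)) * b).
  rewrite mulrDl !mul_tens !mul1r (linear_mapD tl) !tens_umpl_tens.
  rewrite uact_uinjM; last exact: mpl_module.
  by rewrite g2act_g1act !g2act_tens1 [in RHS](addrC (g1act _ _)).
- exists (b + b'); rewrite mulrDr !(linear_mapD tl) (linear_mapD rl) ih ih'.
  by rewrite (linear_mapD (tens_linearr _)) addrACA.
- exists (k *: b); rewrite -scalerAr !(linear_mapZ tl) (linear_mapZ rl) ih.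
  by rewrite (linear_mapZ (tens_linearr _)) scalerDr.
Qed.

Let p2_tens_umpl X c : p2 (tens_umpl X c) = 0.
Proof.
move: c; apply: tens_linear_ext => [||a b].
- exact: linear_map_comp p2l (tens_umpl_linear X).
- by move=> k x y; rewrite scaler0 addr0.
- by rewrite tens_umpl_tens p2_g1act.
Qed.

Lemma upsi_uinj v X :
  upsi mp v (uinj X) = tens_umpl X (ucoprod v) + tens 1 (umpr mp v (uinj X)).
Proof.
(* The map epsilon (x) id kills the part starting in [g1], so whatever remainder b exists must be v
   <| X. *)
suff [b e] : exists b, upsi mp v (uinj X) = tens_umpl X (ucoprod v) + tens 1 b.
  by rewrite /umpr e (linear_mapD p2l) p2_tens_umpl add0r p2_tens1.
rewrite upsiE; have rm := g2act_module mp.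
have ul := uact_linearl rm (tens (uinj X) 1).
have tl := linear_map_comp (tens_umpl_linear X) (@ucoprod_linear F g2).
elim/uenv_left_ind: v => [|c v [b ih]|v v' [b ih] [b' ih']|z v [b ih]].
- exists 0; rewrite uact1 // ucoprod1 tens_umpl_tens uact1; last exact: mpl_module.
  by rewrite g1act_tens mulr1 (linear_map0 (tens_linearr _)) addr0.
- exists (c *: b); rewrite (linear_mapZ ul) ih (linear_mapZ tl).
  by rewrite (linear_mapZ (tens_linearr _)) scalerDr.
- exists (b + b'); rewrite (linear_mapD ul) ih ih' (linear_mapD tl).
  by rewrite (linear_mapD (tens_linearr _)) addrACA.
- have [b' e] := g2act_tens_umpl z X (ucoprod v).
  exists (b' + uinj z * b).
  rewrite uact_uinjM // ih (linear_mapD (g2act_linearr mp z)) e g2act_tens1.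
  by rewrite ucoprodM ucoprod_uinj (linear_mapD (tens_linearr _)) addrA.
Qed.

(** Under id (x) epsilon the remainder of Psi(v (x) X) vanishes and the main term collapses by the
    counit axiom. So v |> X comes from an element of [g1], as the coaction of [g1] requires. *)
Lemma umpl_uinj v X : umpl mp v (uinj X) = uinj (uact (mpl mp) v X).
Proof.
rewrite /umpl upsi_uinj (linear_mapD p1l) [X in _ + X]tlift_tens //.
rewrite ucounit_umpr scale0r addr0 -[in RHS](ucoprod_counit v).
move: (ucoprod v); apply: tens_linear_ext => [||a b].
- exact: linear_map_comp p1l (tens_umpl_linear X).
- apply: linear_map_comp (@uinj_linear F g1) _.
  apply: linear_map_comp (uact_linearl (mpl_module mp) X) _.
  exact: tlift_linear (slice_bilinear _ (@ucounit_linear F g2)).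
- rewrite tens_umpl_tens g1act_tens mulr1 tlift_tens //.
  rewrite tlift_tens; last exact: slice_bilinear (@ucounit_linear F g2).
  rewrite (linear_mapZ (uact_linearl (mpl_module mp) X)).
  by rewrite (linear_mapZ (@uinj_linear F g1)).
Qed.

Lemma umpr_uinj z X : umpr mp (uinj z) (uinj X) = uinj (mpr mp z X).
Proof.
rewrite umprE uact_uinj; last exact: g2act_module.
have -> : tens (uinj X) 1 = g1act X (tens 1 1) :> T by rewrite g1act_tens mulr1.
by rewrite g2act_g1act !(linear_mapD p2l) !p2_g1act !add0r g2act_tens1 p2_tens1 mulr1.
Qed.

Lemma uact_g2act_mulr v (w : T) n :
  uact (g2act mp) v (w * tens 1 n) = uact (g2act mp) v w * tens 1 n.
Proof.
have rm := g2act_module mp; have ul := uact_linearl rm.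
elim/uenv_left_ind: v => [|c v ih|v v' ih ih'|z v ih].
- by rewrite !uact1.
- by rewrite !(linear_mapZ (ul _)) ih scalerAl.
- by rewrite !(linear_mapD (ul _)) ih ih' mulrDl.
- by rewrite !uact_uinjM // ih g2act_mulr.
Qed.

Lemma uact_g2act_tens1 v n : uact (g2act mp) v (tens 1 n) = tens 1 (v * n).
Proof.
have rm := g2act_module mp; have ul := uact_linearl rm (tens 1 n).
elim/uenv_left_ind: v => [|c v ih|v v' ih ih'|z v ih].
- by rewrite uact1 // mul1r.
- by rewrite (linear_mapZ ul) ih -scalerAl (linear_mapZ (@tens_linearr F U1 U2 1)).
- by rewrite (linear_mapD ul) ih ih' mulrDl (linear_mapD (@tens_linearr F U1 U2 1)).
- by rewrite uact_uinjM // ih g2act_tens1 mulrA.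
Qed.

Lemma umpr_umpl_bilinear v X : bilinear_map
  (fun a b : U2 => umpr mp v (uinj (uact (mpl mp) a X)) * b).
Proof.
split=> [b k x y|a]; last exact: linear_map_mull.
rewrite (uact_linearl (mpl_module mp) X k) (uinj_linear k).
by rewrite (umpr_linearr v k) mulrDl -scalerAl.
Qed.

(** Psi(v w (x) X) is v acting on Psi(w (x) X). This expansion is what shows that X |> f stays in
    R(g2). *)
Lemma umprM v w X :
  umpr mp (v * w) (uinj X) =
    tlift (fun a b => umpr mp v (uinj (uact (mpl mp) a X)) * b) (ucoprod w)
    + v * umpr mp w (uinj X).
Proof.
have rm := g2act_module mp.
rewrite umprE uactM // -(upsiE mp w) upsi_uinj (linear_mapD (uact_linearr rm v)).
rewrite uact_g2act_tens1 (linear_mapD p2l) p2_tens1; congr (_ + _).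
move: (ucoprod w); apply: tens_linear_ext => [||a b].
- apply: linear_map_comp p2l _.
  exact: linear_map_comp (uact_linearr rm v) (tens_umpl_linear X).
- exact: tlift_linear (umpr_umpl_bilinear v X).
- rewrite tens_umpl_tens g1act_tens mulr1 (tlift_tens (umpr_umpl_bilinear v X)).
  (* The tensor Y (x) b is split as (Y (x) 1)(1 (x) b), and the right factor commutes with the
     action of v. *)
  by rewrite -[b in tens _ b]mul1r -[uinj _]mulr1 -mul_tens uact_g2act_mulr p2_mulr
    mulr1 -umprE.
Qed.

End MutualActions.

Lemma bilinear_comp (F : fieldType) (V V' W W' Z : lmodType F)
    (b : V' -> W' -> Z) (f : V -> V') (h : W -> W') :
  bilinear_map b -> linear f -> linear h ->
  bilinear_map (fun v w => b (f v) (h w)).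
Proof.
move=> [bl br] fl hl; split=> [w|v].
- exact: linear_map_comp (bl _) fl.
- exact: linear_map_comp (br _) hl.
Qed.

(** * Comodule axioms tested by evaluation *)

Section Coactions.
Variables (F : fieldType) (g : lieAlgType F) (M : lmodType F).
Local Notation R := (repfun g).
Local Notation U := (uenv g).

Lemma rcoprod_linear : linear (@rcoprod F g).
Proof.
move=> c f h; apply/eqP; rewrite -subr_eq0; apply/eqP.
apply: eval2_separated => v w; have el := tlift_linear (eval2_bilinear v w).
by rewrite (linear_mapB el) el !rcoprodE subrr.
Qed.

Lemma rmul_bilinear : bilinear_map (@rmul F g).
Proof.
split=> [h c f f'|f c h h']; apply: repfun_ext => v.
- rewrite -[RHS]/(c *: (rmul f h v) + rmul f' h v) !rmulE.
  move: (ucoprod v); apply: tens_linear_ext => [||a b].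
  + exact: tlift_linear (eval_pair_bilinear _ _).
  + apply: linear_map_add; last exact: tlift_linear (eval_pair_bilinear _ _).
    by apply: linear_map_scale; apply: tlift_linear (eval_pair_bilinear _ _).
  + rewrite !(tlift_tens (eval_pair_bilinear _ _)).
    by rewrite -[_ a]/(c * (f a : F) + f' a) mulrDl -mulrA.
- rewrite -[RHS]/(c *: (rmul f h v) + rmul f h' v) !rmulE.
  move: (ucoprod v); apply: tens_linear_ext => [||a b].
  + exact: tlift_linear (eval_pair_bilinear _ _).
  + apply: linear_map_add; last exact: tlift_linear (eval_pair_bilinear _ _).
    by apply: linear_map_scale; apply: tlift_linear (eval_pair_bilinear _ _).
  + rewrite !(tlift_tens (eval_pair_bilinear _ _)).
    by rewrite -[_ b]/(c * (h b : F) + h' b) mulrDr mulrCA.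
Qed.

Let ev (v w : U) : tensor M (tensor R R) -> M :=
  tlift (fun m (x : tensor R R) =>
    (tlift (fun f1 f2 : R => (f1 v : F) * f2 w : F^o) x : F) *: m).

Let ev_bilinear (v w : U) : bilinear_map (fun (m : M) (x : tensor R R) =>
  (tlift (fun f1 f2 : R => (f1 v : F) * f2 w : F^o) x : F) *: m).
Proof. exact: slice_bilinear (tlift_linear (eval2_bilinear v w)). Qed.

Lemma eval_rcoprod v w t : ev v w (tmap id (@rcoprod F g) t) = tens_at t (v * w).
Proof.
have bl := bilinear_comp (@tens_bilinear F M (tensor R R))
  (@linear_map_id F M) rcoprod_linear.
move: t; apply: tens_linear_ext => [||m f].
- exact: linear_map_comp (tlift_linear (ev_bilinear v w)) (tlift_linear bl).
- exact: tens_at_linear.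
- by rewrite /tmap (tlift_tens bl) /ev (tlift_tens (ev_bilinear v w))
    rcoprodE tens_at_tens.
Qed.

Lemma eval_coaction2 (nabla : M -> tensor M R) v w t : linear nabla ->
  ev v w (tassoc (tmap nabla id t)) = tens_at (nabla (tens_at t w)) v.
Proof.
move=> nl; have bl := bilinear_comp (@tens_bilinear F (tensor M R) R) nl
  (@linear_map_id F R).
have bi (z : R) : bilinear_map (fun (v : M) (w : R) => tens v (tens w z)).
  apply: bilinear_comp (@tens_bilinear F M _) (@linear_map_id F M) _.
  exact: tens_linearl.
have bo : bilinear_map (fun (x : tensor M R) (z : R) =>
    tlift (fun (v : M) (w : R) => tens v (tens w z)) x).
  split=> [z|x]; first exact: tlift_linear (bi z).
  apply: tlift_fun_linear => // m f.
  exact: linear_map_comp (tens_linearr m) (tens_linearr f).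
have evl := tlift_linear (ev_bilinear v w).
move: t; apply: tens_linear_ext => [||m f].
- apply: linear_map_comp evl _.
  exact: linear_map_comp (tlift_linear bo) (tlift_linear bl).
- apply: linear_map_comp (tens_at_linear v) _.
  exact: linear_map_comp nl (tens_at_linear w).
- rewrite /tmap (tlift_tens bl) /tassoc (tlift_tens bo) tens_at_tens (linear_mapZ nl).
  move: (nabla m); apply: tens_linear_ext => [||m' f'].
  + exact: linear_map_comp evl (tlift_linear (bi f)).
  + apply: linear_map_comp (tens_at_linear v) _.
    exact: linear_map_scale (@linear_map_id _ _).
  + rewrite (tlift_tens (bi f)) /ev (tlift_tens (ev_bilinear v w)).
    rewrite (tlift_tens (eval2_bilinear v w)) (linear_mapZ (tens_at_linear v)).
    by rewrite tens_at_tens scalerA mulrC.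
Qed.

(** Evaluating at v (x) w separates the triple tensor product and turns coassociativity into
    multiplicativity of v |-> (m |-> m_<1>(v) m_<0>). *)
Lemma coassociativeP (nabla : M -> tensor M R) : linear nabla ->
  (forall m, tassoc (tmap nabla id (nabla m)) = tmap id (@rcoprod F g) (nabla m))
  <-> (forall m v w,
         tens_at (nabla (tens_at (nabla m) w)) v = tens_at (nabla m) (v * w)).
Proof.
move=> nl; split=> [e m v w|e m].
  by rewrite -eval_rcoprod -e eval_coaction2.
by apply: tens_at2_inj => v w; rewrite -!/(ev v w) /= eval_coaction2 // eval_rcoprod.
Qed.

Lemma rcounit_tens_at (t : tensor M R) :
  tlift (fun m0 f => rcounit f *: m0) t = tens_at t 1.
Proof. by []. Qed.

End Coactions.

(** * The compatibility condition after evaluation *)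

Section Induced.
Variables (F : fieldType) (g1 g2 : lieAlgType F) (mp : matched_pair g1 g2).
Local Notation U2 := (uenv g2).
Local Notation R := (repfun g2).
Local Notation e1 := (vbasis (fullv : {vspace g1})).

Lemma ractE X (f : R) v : ract mp X f v = f (umpr mp v (uinj X)).
Proof.
rewrite /ract to_repfunE //; apply: finite_rank_is_representative.
  exact: linear_map_comp (repfun_linear f) (umpr_linearl mp (uinj X)).
have [n [G [H fE]]] := repfun_decomposition f.
pose c i a : F^o := coord e1 i (uact (mpl mp) a X).
have cl i : linear (c i).
  by move=> k a b; rewrite /c (uact_linearl (mpl_module mp) X k) linearP.
have cb i k : bilinear_map (fun a b => (c i a : F) * H k b : F^o).
  split=> [b k' x y|a k' x y].
  - by rewrite cl -[_ *: _ + _]/(k' * c i x + c i y) mulrDl -mulrA.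
  - by rewrite (repfun_linear (H k)) -[_ *: _ + _]/(k' * (H k x : F) + H k y)
      mulrDr mulrCA.
(* The left summand indexes (v <| (w_(1) |> X)) w_(2), with w_(1) |> X expanded on a basis of [g1]
   and f split by G_k and H_k; the right summand indexes v (w <| X). *)
exists ('I_(\dim (fullv : {vspace g1})) * 'I_n + 'I_n)%type,
  (fun (j : 'I_(\dim (fullv : {vspace g1})) * 'I_n + 'I_n) v => match j with
    | inl ik => G ik.2 (umpr mp v (uinj e1`_ik.1)) | inr k => G k v end),
  (fun j w => match j with
    | inl ik => tlift (fun a b => (c ik.1 a : F) * H ik.2 b : F^o) (ucoprod w)
    | inr k => H k (umpr mp w (uinj X)) end).
move=> v' w; rewrite umprM (linear_mapD (repfun_linear f)) fE big_sumType /=.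
congr (_ + _); have ub := umpr_umpl_bilinear mp v' X.
move: (ucoprod w); apply: (@tens_linear_ext F _ _ F^o) => [||a b].
- exact: linear_map_comp (repfun_linear f) (tlift_linear ub).
- apply: linear_map_sumf => j; apply: (@linear_map_scale _ _ F^o).
  exact: tlift_linear (cb _ _).
rewrite (tlift_tens ub) fE.
rewrite -(pair_bigA _ (fun (i : 'I_(\dim (fullv : {vspace g1}))) k =>
  (G k (umpr mp v' (uinj e1`_i)) : F) *
  tlift (fun a b => (c i a : F) * H k b : F^o) (tens a b))) exchange_big /=.
apply: eq_bigr => k _.
have Gl : linear (fun Y => G k (umpr mp v' (uinj Y))).
  move=> d Y Y'; rewrite (uinj_linear d) (umpr_linearr mp v' d).
  exact: repfun_linear.
rewrite (linear_map_vbasis _ Gl) mulr_suml; apply: eq_bigr => i _.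
by rewrite (tlift_tens (cb i k)) mulrCA mulrA.
Qed.

Lemma ract_linear X : linear (ract mp X : R -> R).
Proof.
by move=> c f h; apply: repfun_ext => v;
  rewrite ractE -[RHS]/(c *: ract mp X f v + ract mp X h v) !ractE.
Qed.

(** Being finite dimensional, [g1] is locally finite under |>, so the coaction already built for
    such modules is a witness. *)
Lemma gcoactE v X : umpl mp v (uinj X) = uinj (tens_at (gcoact mp X) v).
Proof.
have [t tP] := locally_finite_coaction (mpl_module mp)
  (@finite_dim_locally_finite F g2 g1 (mpl mp)) X.
have := @xgetPex _ 0 [set t : tensor g1 R |
  forall v, umpl mp v (uinj X) = uinj (tens_at t v)]%classic.
apply; exists t => v' /=.
by rewrite umpl_uinj tP.
Qed.

Section Module1.
Variables (M : lmodType F) (act : g1 -> M -> M).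
Hypothesis act_mod : is_lie_module act.

(* gcoact is only determined up to the kernel of g1 -> U(g1), which acts
   trivially on every g1-module. *)
Lemma act_gcoact X v m :
  act (tens_at (gcoact mp X) v) m = act (uact (mpl mp) v X) m.
Proof.
by rewrite -!(uact_uinj act_mod) -gcoactE umpl_uinj.
Qed.

Let act_bilinear : bilinear_map act := act_mod.1.

Lemma act_tens_at_bilinear (t : tensor g1 R) (s : tensor M R) :
  bilinear_map (fun a b => act (tens_at t a) (tens_at s b)).
Proof.
exact: bilinear_comp act_bilinear (tens_at_linearr t) (tens_at_linearr s).
Qed.

Lemma tens_at_codiagonal (t : tensor g1 R) (s : tensor M R) v :
  tens_at (tlift (fun (X0 : g1) (X1 : R) =>
    tlift (fun m0 m1 => tens (act X0 m0) (rmul X1 m1)) s) t) v =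
  tlift (fun a b => act (tens_at t a) (tens_at s b)) (ucoprod v).
Proof.
have [rl rr] := rmul_bilinear g2.
have bi X0 (X1 : R) : bilinear_map (fun (m0 : M) (m1 : R) =>
    tens (act X0 m0) (rmul X1 m1)).
  exact: bilinear_comp (@tens_bilinear F M R) (act_bilinear.2 X0) (rr X1).
have bo : bilinear_map (fun (X0 : g1) (X1 : R) =>
    tlift (fun m0 m1 => tens (act X0 m0) (rmul X1 m1)) s).
  split=> [X1|X0]; apply: tlift_fun_linear => // m0 m1.
  - exact: linear_map_comp (tens_linearl _) (act_bilinear.1 m0).
  - exact: linear_map_comp (tens_linearr _) (rl m1).
move: t; apply: tens_linear_ext => [||X0 X1].
- exact: linear_map_comp (tens_at_linear v) (tlift_linear bo).
- apply: tlift_fun_linear => [t|a b]; first exact: act_tens_at_bilinear.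
  exact: linear_map_comp (act_bilinear.1 _) (tens_at_linear a).
rewrite (tlift_tens bo).
move: s {bo}; apply: tens_linear_ext => [||m0 m1].
- exact: linear_map_comp (tens_at_linear v) (tlift_linear (bi X0 X1)).
- apply: tlift_fun_linear => [s|a b]; first exact: act_tens_at_bilinear.
  exact: linear_map_comp (act_bilinear.2 _) (tens_at_linear b).
rewrite (tlift_tens (bi X0 X1)) tens_at_tens rmulE.
move: (ucoprod v); apply: tens_linear_ext => [||a b].
- by apply: linear_map_scalel; apply: tlift_linear (eval_pair_bilinear X1 m1).
- exact: tlift_linear (act_tens_at_bilinear _ _).
rewrite (tlift_tens (eval_pair_bilinear X1 m1)) (tlift_tens (act_tens_at_bilinear _ _)).
rewrite !tens_at_tens (linear_mapZ (act_bilinear.1 _)) (linear_mapZ (act_bilinear.2 _)).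
by rewrite scalerA.
Qed.

Lemma tens_at_ract X (s : tensor M R) v :
  tens_at (tlift (fun m0 m1 => tens m0 (ract mp X m1)) s) v =
  tens_at s (umpr mp v (uinj X)).
Proof.
have bl := bilinear_comp (@tens_bilinear F M R) (@linear_map_id F M) (ract_linear X).
move: s; apply: tens_linear_ext => [||m f].
- exact: linear_map_comp (tens_at_linear v) (tlift_linear bl).
- exact: tens_at_linear.
- by rewrite (tlift_tens bl) !tens_at_tens ractE.
Qed.

Lemma induced_compatP (nabla : M -> tensor M R) :
  (forall X m,
     nabla (act X m) =
       tlift (fun (X0 : g1) (X1 : R) =>
         tlift (fun m0 m1 => tens (act X0 m0) (rmul X1 m1)) (nabla m)) (gcoact mp X)
       + tlift (fun m0 m1 => tens m0 (ract mp X m1)) (nabla m))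
  <-> (forall X m v,
     tens_at (nabla (act X m)) v =
       tlift (fun a b => act (uact (mpl mp) a X) (tens_at (nabla m) b)) (ucoprod v)
       + tens_at (nabla m) (umpr mp v (uinj X))).
Proof.
have E X m v : tens_at (tlift (fun (X0 : g1) (X1 : R) =>
    tlift (fun m0 m1 => tens (act X0 m0) (rmul X1 m1)) (nabla m)) (gcoact mp X)
    + tlift (fun m0 m1 => tens m0 (ract mp X m1)) (nabla m)) v =
    tlift (fun a b => act (uact (mpl mp) a X) (tens_at (nabla m) b)) (ucoprod v)
    + tens_at (nabla m) (umpr mp v (uinj X)).
  rewrite (linear_mapD (tens_at_linear v)) tens_at_codiagonal tens_at_ract.
  by congr (_ + _); apply: eq_tlift => a b; rewrite act_gcoact.
split=> [e X m v|e X m]; first by rewrite e E.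
by apply: tens_at_inj => v; rewrite e E.
Qed.

End Module1.

(** * From modules over the double crossed sum to induced modules *)

Section Restriction.
Variables (M : lmodType F) (act : dcsum mp -> M -> M).
Hypothesis act_mod : is_lie_module act.

Lemma restrict1_module : is_lie_module (restrict1 act).
Proof.
have [[al ar] alie] := act_mod.
split=> [|X Y m]; last by rewrite /restrict1 -lie_dcinl alie.
split=> [m|X]; last exact: ar.
exact: linear_map_comp (al m) (@dcinl_linear F g1 g2 mp).
Qed.

Lemma restrict2_module : is_lie_module (restrict2 act).
Proof.
have [[al ar] alie] := act_mod.
split=> [|X Y m]; last by rewrite /restrict2 -lie_dcinr alie.
split=> [m|X]; last exact: ar.
exact: linear_map_comp (al m) (@dcinr_linear F g1 g2 mp).
Qed.

Lemma uact_uinr v m : uact act (uinr mp v) m = uact (restrict2 act) v m.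
Proof.
have ul := uact_linearl act_mod m; have ul2 := uact_linearl restrict2_module m.
elim/uenv_left_ind: v => [|c v ih|v v' ih ih'|z v ih].
- by rewrite uinr1 !uact1 //; apply: restrict2_module.
- by rewrite (linear_mapZ (uinr_linear mp)) (linear_mapZ ul) (linear_mapZ ul2) ih.
- by rewrite (linear_mapD (uinr_linear mp)) (linear_mapD ul) (linear_mapD ul2) ih ih'.
- by rewrite uinrM uinr_uinj (uact_uinjM act_mod) ih (uact_uinjM restrict2_module).
Qed.

(** The product v X is rewritten as the image of Psi(v (x) X), whose two summands act on m as the
    two terms on the right. *)
Lemma uact_restrict2_restrict1 v X m :
  uact (restrict2 act) v (restrict1 act X m) =
    tlift (fun a b => restrict1 act (uact (mpl mp) a X) (uact (restrict2 act) b m))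
      (ucoprod v)
    + uact (restrict2 act) (umpr mp v (uinj X)) m.
Proof.
have ul := uact_linearl act_mod m.
rewrite -uact_uinr /restrict1 -(uact_uinj act_mod) -uactM // -uinl_uinj.
have -> : uinr mp v * uinl mp (uinj X) = umult mp (upsi mp v (uinj X)).
  by rewrite upsiE umult_uact umult_tens uinr1 mulr1.
rewrite upsi_uinj (linear_mapD (umult_linear mp)) (linear_mapD ul).
rewrite umult_tens uinl1 mul1r uact_uinr; congr (_ + _).
have bl : bilinear_map (fun a b =>
    restrict1 act (uact (mpl mp) a X) (uact (restrict2 act) b m)).
  apply: bilinear_comp restrict1_module.1 _ _.
  - exact: uact_linearl (mpl_module mp) X.
  - exact: uact_linearl restrict2_module m.
move: (ucoprod v); apply: tens_linear_ext => [||a b].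
- apply: linear_map_comp ul _.
  exact: linear_map_comp (umult_linear mp) (tens_umpl_linear mp X).
- exact: tlift_linear bl.
- rewrite tens_umpl_tens umult_g1act umult_tens uinl1 mul1r (tlift_tens bl).
  by rewrite uact_uinjM // uact_uinr.
Qed.

Lemma induced_of_module : locally_finite (restrict2 act) ->
  exists nabla : M -> tensor M R,
    [/\ coaction_determined_by (restrict2 act) nabla,
        forall nabla' : M -> tensor M R,
          coaction_determined_by (restrict2 act) nabla' -> nabla' = nabla
      & is_induced_module mp (restrict1 act) nabla].
Proof.
move=> lf; have r2 := restrict2_module; have r1 := restrict1_module.
have [nabla nP] := choice (locally_finite_coaction r2 lf).
have nl : linear nabla.
  move=> c m m'; apply: tens_at_inj => v.
  by rewrite (tens_at_linear v) !nP (uact_linearr r2).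
exists nabla; split=> [m v|nabla' n'P|].
- by rewrite nP.
- by apply: funext => m; apply: tens_at_inj => v; rewrite -n'P nP.
- split=> //; first split=> //.
  + by apply/(coassociativeP nl) => m v w; rewrite !nP uactM.
  + by move=> m; rewrite rcounit_tens_at nP uact1.
  + apply/(induced_compatP r1) => X m v; rewrite !nP uact_restrict2_restrict1.
    by congr (_ + _); apply: eq_tlift => a b; rewrite nP.
Qed.

End Restriction.

(** * From induced modules to modules over the double crossed sum *)

Lemma module_of_induced (M : lmodType F) (act1 : g1 -> M -> M)
    (nabla : M -> tensor M R) : is_induced_module mp act1 nabla ->
  exists act : dcsum mp -> M -> M,
    [/\ is_lie_module act, locally_finite (restrict2 act), restrict1 act = act1
      & coaction_determined_by (restrict2 act) nabla].
Proof.
move=> [a1 [nl /(coassociativeP nl) nM n1] /(induced_compatP a1) nc].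
pose um v m := tens_at (nabla m) v.
have uml m : linear (um^~ m) by apply: tens_at_linearr.
have umr v : linear (um v) by apply: linear_map_comp (tens_at_linear v) nl.
have umM v w m : um (v * w) m = um v (um w m) by rewrite /um nM.
have um1 m : um 1 m = m by rewrite /um -rcounit_tens_at.
have [[al ar] alie] := a1.
(* This is the compatibility at v = z, where z is primitive; it is the mixed bracket relation
   between [g1] and [g2]. *)
have cross z X m : um (uinj z) (act1 X m) =
    act1 X (um (uinj z) m) + act1 (mpl mp z X) m + um (uinj (mpr mp z X)) m.
  rewrite {1}/um nc umpr_uinj ucoprod_uinj -/(um _ _); congr (_ + _).
  have bl : bilinear_map (fun a b => act1 (uact (mpl mp) a X) (tens_at (nabla m) b)).
    apply: bilinear_comp a1.1 _ _; last exact: tens_at_linearr.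
    exact: uact_linearl (mpl_module mp) X.
  rewrite (linear_mapD (tlift_linear bl)) !(tlift_tens bl) -!/(um _ m) um1.
  by rewrite (uact1 (mpl_module mp)) (uact_uinj (mpl_module mp)) addrC.
pose act (y : dcsum mp) m := act1 y.1 m + um (uinj y.2) m.
have act2E z m : restrict2 act z m = um (uinj z) m.
  by rewrite /restrict2 /act /= (linear_map0 (al m)) add0r.
have act_mod : is_lie_module act.
  split=> [|y y' m].
    split=> [m c y y'|y]; last exact: linear_map_add (ar _) (umr _).
    rewrite /act /= (al m c) (@uinj_linear F g2 c) (uml m c) scalerDr.
    exact: addrACA.
  rewrite /act /= !(linear_mapB (al m), linear_mapD (al m)).
  rewrite !(linear_mapD (@uinj_linear F g2)) !(linear_mapN (@uinj_linear F g2)).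
  rewrite !(linear_mapD (uml m)) ?(linear_mapN (uml m)) uinj_lie (linear_mapB (uml m)).
  rewrite !umM alie !(linear_mapD (ar _), linear_mapD (umr _)) !cross.
  zmod_eq.
exists act; split=> //.
- move=> m; have [s sE] := tensor_sum (nabla m).
  (* Writing the coaction of m as a finite sum of m_i (x) f_i, the vector v m depends linearly on
     the row of the f_i(v). Points t_j whose rows span all rows therefore give vectors t_j m
     spanning U(g2) m. *)
  pose f v : 'rV[F]_(size s) := \row_i (tnth (in_tuple s) i).2 v.
  have [k [t tP]] := finite_spanning_values f.
  exists k, (fun j => um (t j) m) => span.
  have umE v : um v m = \sum_i f v 0 i *: (tnth (in_tuple s) i).1.
    rewrite /um sE (linear_map_sum _ _ _ (tens_at_linear v)) big_tnth.
    by apply: eq_bigr => i _; rewrite tens_at_tens mxE.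
  have um_span v : span (um v m).
    have [c fE] := tP v; exists c; rewrite umE fE.
    transitivity (\sum_i \sum_j (c j * f (t j) 0 i) *: (tnth (in_tuple s) i).1).
      apply: eq_bigr => i _; rewrite summxE scaler_suml.
      by apply: eq_bigr => j _; rewrite mxE.
    rewrite exchange_big; apply: eq_bigr => j _; rewrite umE scaler_sumr.
    by apply: eq_bigr => i _; rewrite scalerA.
  split=> [|z p [c ->]]; first by rewrite -(um1 m).
  (* A vector of the span is again of the form v m, so applying z gives (z v) m, which stays in the
     span. *)
  have := um_span (uinj z * \sum_j c j *: t j).
  rewrite umM (linear_map_sum _ _ _ (uml m)) act2E.
  by under eq_bigr do rewrite (linear_mapZ (uml m)).
- apply: funext => X; apply: funext => m; rewrite /restrict1 /act /=.
  by rewrite (linear_map0 (@uinj_linear F g2)) (linear_map0 (uml m)) addr0.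
- move=> m v; rewrite -/(um v m).
  have r2 := restrict2_module act_mod; have ul := uact_linearl r2 m.
  elim/uenv_left_ind: v => [|c v ih|v v' ih ih'|z v ih].
  + by rewrite uact1.
  + by rewrite (linear_mapZ ul) (linear_mapZ (uml m)) ih.
  + by rewrite (linear_mapD ul) (linear_mapD (uml m)) ih ih'.
  + by rewrite uact_uinjM // act2E ih umM.
Qed.

End Induced.

Theorem proposition3p7 (R : realType) (g1 g2 : lieAlgType R[i])
    (mp : matched_pair g1 g2) (M : lmodType R[i]) :
  (forall act : dcsum mp -> M -> M,
     is_lie_module act ->
     locally_finite (restrict2 act) ->
     exists nabla : M -> tensor M (repfun g2),
       [/\ coaction_determined_by (restrict2 act) nabla,
           forall nabla' : M -> tensor M (repfun g2),
             coaction_determined_by (restrict2 act) nabla' -> nabla' = nabla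
         & is_induced_module mp (restrict1 act) nabla])
  /\
  (forall (act1 : g1 -> M -> M) (nabla : M -> tensor M (repfun g2)),
     is_induced_module mp act1 nabla ->
     exists act : dcsum mp -> M -> M,
       [/\ is_lie_module act,
           locally_finite (restrict2 act),
           restrict1 act = act1
         & coaction_determined_by (restrict2 act) nabla]).
Proof.
split=> [act act_mod lf|act1 nabla ind].
- exact: induced_of_module.
- exact: module_of_induced.
Qed.
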